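(* Let $T>0$, $\xi\in\mathbb{R}^d$, $F\in C^3_b(\mathbb{R}^d,\mathcal{L}(\mathbb{R}^n,\mathbb{R}^d))$, and let $\mathbf{W}=(W,\mathbb{W})$ be a $\beta$-Hölder rough path on $[0,T]$ with $W$ taking values in $\mathbb{R}^n$ and $\beta\in(1/3,1/2)$. There is a unique controlled rough path $(y,y')\in\mathscr{D}^{2\beta}_W(\mathbb{R}^d)$ such that for all $t\in[0,T]$, $$y(t)=\xi+\int_0^tF(y_u)\,\mathrm{d}\mathbf{W}_u,$$ where the integral is to be understood as the controlled rough path integral.
   Context: For a path $Z$ write $Z_{s,t}:=Z_t-Z_s$. $\mathcal{L}(A,B)$ is the space of continuous linear maps from $A$ to $B$. $C^3_b$ is the set of $C^3$ functions which are bounded together with their derivatives up to order $3$. A $\beta$-Hölder rough path is a pair $(W,\mathbb{W})$, $W:[0,T]\to\mathbb{R}^n$, $\mathbb{W}:[0,T]^2\to\mathbb{R}^n\otimes\mathbb{R}^n$, with $\mathbb{W}_{s,t}-\mathbb{W}_{s,u}-\mathbb{W}_{u,t}=W_{s,u}\otimes W_{u,t}$ for all $s,u,t\in[0,T]$, $\sup_{s\neq t}\|W_{s,t}\|/|t-s|^\beta<\infty$ and $\sup_{s\neq t}\|\mathbb{W}_{s,t}\|/|t-s|^{2\beta}<\infty$. For a finite-dimensional normed space $E$, $\mathscr{D}^{2\beta}_W(E)$ is the space of controlled rough paths: pairs $(y,y')$ of $\beta$-Hölder functions $y:[0,T]\to E$, $y':[0,T]\to\mathcal{L}(\mathbb{R}^n,E)$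 such that $y_{s,t}=y'_sW_{s,t}+R^y_{s,t}$ with $\sup_{s\neq t}\|R^y_{s,t}\|/|t-s|^{2\beta}<\infty$. For $(z,z')\in\mathscr{D}^{2\beta}_W(\mathcal{L}(\mathbb{R}^n,\mathbb{R}^d))$ the controlled rough path integral is $\int_0^tz_u\,\mathrm{d}\mathbf{W}_u:=\lim_{|\mathcal{P}|\to0}\sum_{u,v\in\mathcal{P}}\left(z_uW_{u,v}+z'_u\mathbb{W}_{u,v}\right)$, the limit being over subdivisions $\mathcal{P}$ of $[0,t]$ with mesh tending to $0$ and the sum over successive points $u,v$ of $\mathcal{P}$ (the limit exists and does not depend on the choice of subdivisions), with $z'_u\mathbb{W}_{u,v}:=\sum_{i,j=1}^n(z'_ue_i)(e_j)\mathbb{W}^{i,j}_{u,v}$, where $(e_i)$ is the canonical basis of $\mathbb{R}^n$. For $(y,y')\in\mathscr{D}^{2\beta}_W(\mathbb{R}^d)$, the integrand $F(y)$ is the controlled rough path $z_t=F(y_t)$, $z'_t=F'(y_t)y'_t$, i.e. $z'_tv=F'(y_t)(y'_tv)$ for $v\in\mathbb{R}^n$.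
   Formalization: A solution is also required to satisfy y'_t = F(y_t) on [0,T]; without this, uniqueness of (y,y') fails (for W = 0 and zero second-order part, y = ξ with any β-Hölder y' solves the equation). *)

(* Defs.v *)
From HB Require Import structures.
From mathcomp Require Import all_boot all_order all_algebra.
From mathcomp Require Import all_classical all_reals all_analysis.

Set Implicit Arguments.
Unset Strict Implicit.
Unset Printing Implicit Defensive.

Import Order.TTheory GRing.Theory Num.Theory.
Import numFieldNormedType.Exports.

Local Open Scope ring_scope.

(* R^n is 'cV[R]_n, L(R^n, R^d) is 'M[R]_(d, n) acting by *m, and the tensor
   product of R^n with itself is 'M[R]_n, with u (x) v = u *m v^T.  Paths on
   [0, T] are functions on R of which only the values on [0, T] matter. *)

Definition incr (R : realType) (V : zmodType) (Z : R -> V) (s t : R) : V :=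
  Z t - Z s.

Definition holder2 (R : realType) (V : normedModType R) (T a : R)
    (A : R -> R -> V) : Prop :=
  exists C : R, forall s t, 0 <= s <= T -> 0 <= t <= T -> s != t ->
    `|A s t| / (`|t - s| `^ a) <= C.

Definition rough_path (R : realType) (n : nat) (T beta : R)
    (W : R -> 'cV[R]_n) (WW : R -> R -> 'M[R]_n) : Prop :=
  [/\ forall s u t, 0 <= s <= T -> 0 <= u <= T -> 0 <= t <= T ->
        WW s t - WW s u - WW u t = incr W s u *m (incr W u t)^T,
      holder2 T beta (incr W)
    & holder2 T (2 * beta) WW].

Definition controlled_rough_path (R : realType) (n d : nat) (T beta : R)
    (W : R -> 'cV[R]_n) (y : R -> 'cV[R]_d) (y' : R -> 'M[R]_(d, n)) : Prop :=
  [/\ holder2 T beta (incr y),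
      holder2 T beta (incr y')
    & holder2 T (2 * beta) (fun s t => incr y s t - y' s *m incr W s t)].

Definition germ (R : realType) (n d : nat)
    (W : R -> 'cV[R]_n) (WW : R -> R -> 'M[R]_n)
    (z : R -> 'M[R]_(d, n)) (z' : R -> {linear 'cV[R]_n -> 'M[R]_(d, n)})
    (u v : R) : 'cV[R]_d :=
  z u *m incr W u v
  + \sum_(i < n) \sum_(j < n)
      WW u v i j *: (z' u (delta_mx i 0) *m (delta_mx j 0 : 'cV[R]_n)).

(* Subdivisions 0 = p 0 < ... < p (size s) = t of [0, t] are given by
   [itv_partition 0 t s], with p = nth 0 (0 :: s). *)
Definition has_rough_integral (R : realType) (n d : nat)
    (W : R -> 'cV[R]_n) (WW : R -> R -> 'M[R]_n)
    (z : R -> 'M[R]_(d, n)) (z' : R -> {linear 'cV[R]_n -> 'M[R]_(d, n)})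
    (t : R) (I : 'cV[R]_d) : Prop :=
  forall e : R, 0 < e -> exists2 delta : R, 0 < delta &
    forall s : seq R, itv_partition 0 t s ->
      let p := nth 0 (0 :: s) in
      (forall k, (k < size s)%N -> p k.+1 - p k < delta) ->
      `|\sum_(0 <= k < size s) germ W WW z z' (p k) (p k.+1) - I| < e.

(* C^k_b.  Since V = R^m is finite dimensional, the derivative
   x |-> 'd f x is C^k_b into L(V, E) iff x |-> 'd f x v is C^k_b into E for
   every v (v ranging over a basis gives the coordinates of 'd f x). *)
Fixpoint Cb (R : realType) (m : nat) (E : normedModType R) (k : nat)
    (f : 'cV[R]_m -> E) : Prop :=
  (exists M : R, forall x, `|f x| <= M) /\
  match k with
  | 0 => continuous f
  | k'.+1 => (forall x, differentiable f x) /\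
             (forall v, Cb k' (fun x => 'd f x v))
  end.

Definition comp_deriv (R : realType) (n d : nat)
    (F : 'cV[R]_d -> 'M[R]_(d, n))
    (y : R -> 'cV[R]_d) (y' : R -> 'M[R]_(d, n)) (t : R) :
    {linear 'cV[R]_n -> 'M[R]_(d, n)} :=
  ('d F (y t) \o mulmx (y' t)).

(* The rough integral of (z, z') is itself the controlled rough path
   (\int z dW, z), so the equation, read between controlled rough paths, also
   says y' = F(y).  This is not implied by the equation for y alone, and
   uniqueness fails without it: if W = 0 and WW s t = (t - s) *: A, then y' can
   be any beta-Hoelder path, and y depends on it. *)
Definition rde_solution (R : realType) (n d : nat) (T beta : R)
    (W : R -> 'cV[R]_n) (WW : R -> R -> 'M[R]_n)
    (F : 'cV[R]_d -> 'M[R]_(d, n)) (xi : 'cV[R]_d)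
    (y : R -> 'cV[R]_d) (y' : R -> 'M[R]_(d, n)) : Prop :=
  controlled_rough_path T beta W y y' /\
  forall t, 0 <= t <= T ->
    (exists2 I, has_rough_integral W WW (F \o y) (comp_deriv F y y') t I
              & y t = xi + I) /\
    y' t = F (y t).

(* Main.v *)
From HB Require Import structures.
Require Import Defs.
From mathcomp Require Import all_boot all_order all_algebra.
From mathcomp Require Import all_classical all_reals all_analysis.
From mathcomp Require Import ring lra.

Set Implicit Arguments.
Unset Strict Implicit.
Unset Printing Implicit Defensive.

Import Order.TTheory GRing.Theory Num.Theory.
Import numFieldNormedType.Exports.
Local Open Scope ring_scope.

(** The equation is solved by an Euler scheme of second order.  Put
    mu s t x = x + F(x) W_{s,t} + F'(x)(F(x) .) WW_{s,t}, the Davie step, and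
    theta = 3 beta > 1.  A pair (y, F(y)) solves the equation exactly when
    y 0 = xi and y is a Davie path: y_t = mu s t y_s + O(|t - s|^theta) for
    s <= t.  It is this condition that has a unique solution.

    From an equation to a Davie path ([solution_davie]).  For a controlled path
    with y' = F(y) the germ of the rough integral is additive up to
    O(|t - s|^theta), by Chen's relation and Taylor's formula.  Sewing then
    compares the integral over [s, t] with the germ.  Conversely, for a Davie
    path the Riemann sums of the germ telescope to y up to the sum of the
    |v - u|^theta, which tends to 0 with the mesh ([davie_solution]).

    Existence and uniqueness of Davie paths only use that mu is an almost flow
    ([lipschitz_almost_flow]): mu s t is close to the identity in C^{1,1}, and
    mu u t o mu s u - mu s t has sup norm and Lipschitz constant
    O(|t - s|^theta).  This is where three bounded derivatives of F are spent
    ([davie_step_flow]).  The central estimates, [scheme_defect] and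
    [scheme_defect_lip], say that an Euler scheme along any partition of a
    short interval differs from one single step by O(|t - s|^theta), in sup
    norm and in Lipschitz norm, uniformly in the partition.  They are proved by
    cutting the time interval in halves: since 2 * 2^(-theta) < 1, the two
    errors of the halves leave room for the error of composing them.  Hence all
    Euler schemes are Lipschitz with one constant, local errors simply add up
    ([approx_scheme]), the schemes along dyadic partitions converge to a Davie
    path ([almost_flow_exists]), and any two Davie paths with the same origin
    are limits of the same schemes ([almost_flow_unique]).

    Regularity of F enters only through differences: a function is called C11
    here when it is bounded and Lipschitz and satisfies the four-point
    inequality, which is what a bounded Lipschitz derivative gives along
    segments.  This class is stable under sums and products, so the second
    order coefficient of mu needs no derivative of its own. *)

(** * Abelian group identities and real powers *)

Lemma cancel_step (V : zmodType) (A A' x y : V) :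
  A = A' + x -> A + y = A' + y + x.
Proof. by move=> ->; rewrite addrAC. Qed.

(** Atoms are compared up to conversion, because the same operation may be
    reached through different paths in the hierarchy of structures. *)
Ltac same x y := let _ := match goal with _ => unify x y end in constr:(tt).

Ltac bring x S :=
  match S with
  | x => constr:(esym (add0r x))
  | ?y => let _ := same x y in constr:(esym (add0r y))
  | ?A + x => constr:(erefl S)
  | ?A + ?y => let _ := same x y in constr:(erefl S)
  | ?A + ?y => let pf := bring x A in constr:(@cancel_step _ _ _ _ y pf)
  end.

Ltac bring_opp x S :=
  match S with
  | - x => constr:(esym (add0r S))
  | - ?y => let _ := same x y in constr:(esym (add0r S))
  | ?A - x => constr:(erefl S)
  | ?A - ?y => let _ := same x y in constr:(erefl S)
  | ?A + ?y => let pf := bring_opp x A in constr:(@cancel_step _ _ _ _ y pf)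
  end.

Ltac cancel_last :=
  first [rewrite addrK | rewrite addrNK |
  match goal with
  | |- ?S - ?x = 0 => let pf := bring x S in rewrite pf addrK
  | |- ?S + ?x = 0 => let pf := bring_opp x S in rewrite pf addrNK
  end].

(** Proves identities in a [zmodType]: both sides are expanded into a signed
    sum, whose last term is repeatedly cancelled against an opposite one. *)
Ltac abel :=
  apply/eqP; rewrite -subr_eq0; apply/eqP;
  rewrite ?(opprD, opprK, addrA, oppr0, addr0, add0r);
  repeat (first [reflexivity | rewrite subrr; reflexivity
    | rewrite addNr; reflexivity | cancel_last ]).

Section Powers.
Variable R : realType.
Implicit Types a x y C e h : R.

Lemma powR_mono a x y : 0 <= a -> 0 <= x -> x <= y -> x `^ a <= y `^ a.
Proof.
by move=> a0 x0 xy; apply: ge0_ler_powR; rewrite ?nnegrE// (le_trans x0).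
Qed.

Lemma powR_small a C e : 0 < a -> 0 < e ->
  exists2 h, 0 < h & forall x, 0 <= x -> x <= h -> C * x `^ a <= e.
Proof.
move=> a0 e0; have C1 : 0 < `|C| + 1 by rewrite ltr_wpDl.
have q0 : 0 < e / (`|C| + 1) by rewrite divr_gt0.
exists ((e / (`|C| + 1)) `^ a^-1); first exact: powR_gt0.
move=> x x0 xh.
have : x `^ a <= e / (`|C| + 1).
  have -> : e / (`|C| + 1) = ((e / (`|C| + 1)) `^ a^-1) `^ a.
    by rewrite -powRrM mulVf ?lt0r_neq0// powRr1// ltW.
  exact: powR_mono (ltW a0) x0 xh.
rewrite ler_pdivlMr// => H; apply: le_trans H.
rewrite mulrC; apply: ler_wpM2l; first exact: powR_ge0.
by rewrite (le_trans (ler_norm _))// lerDl.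
Qed.

End Powers.

(** * Euler schemes of almost flows *)

Section Euler.
Variables (R : realType) (V : normedModType R).
Implicit Types (p : nat -> R) (x y : nat -> V) (mu : R -> R -> V -> V).

(** Partitions are nondecreasing sequences of times, indexed by all of [nat].
    Repeated points are allowed, so that clipping a partition to a subinterval
    again gives a partition with the same indices. *)
Definition grid (T : R) p :=
  {homo p : i j / (i <= j)%N >-> i <= j} /\ forall k, 0 <= p k <= T.

Definition exact_scheme mu p x := forall k, x k.+1 = mu (p k) (p k.+1) (x k).

Lemma grid_shift T p k : grid T p -> grid T (fun i => p (k + i)%N).
Proof. by case=> hp pT; split => // i j ij; apply: hp; rewrite leq_add2l. Qed.

Lemma exact_shift mu p x k : exact_scheme mu p x ->
  exact_scheme mu (fun i => p (k + i)%N) (fun i => x (k + i)%N).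
Proof. by move=> ex i; rewrite addnS ex. Qed.

Lemma grid_le T p i j : grid T p -> (i <= j)%N ->
  [/\ 0 <= p i, p i <= p j & p j <= T].
Proof.
by move=> [hp pT] ij; have /andP[? _] := pT i; have /andP[_ ?] := pT j; rewrite hp.
Qed.

Lemma grid_span T p i j n : grid T p -> (i <= j)%N -> (j <= n)%N ->
  p j - p i <= p n - p 0%N.
Proof. by move=> [hp _] ij jn; rewrite lerB// hp. Qed.

Lemma grid_split p c n : (0 < n)%N -> p 0%N <= c -> c <= p n ->
  exists k, [/\ (k < n)%N, p k <= c & c <= p k.+1].
Proof.
elim: n => // n IH _ p0c cpn.
have [cn|nc] := leP c (p n); last by exists n; rewrite (ltW nc).
case: n => [|n] in IH cpn cn *; first by exists 0%N.
have [k [kn ? ?]] := IH isT p0c cn.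
by exists k; split=> //; rewrite ltnS ltnW.
Qed.

Variables (T th : R).
Hypothesis th1 : 1 < th.

(** The gain of a bisection: halving a duration multiplies its power [th] by
    this factor, which is less than 1/2. *)
Definition half_pow : R := 2 `^ (- th).
Local Notation r := half_pow.
(** The Lipschitz distance of a step to the identity below which the errors of the two
    halves of an interval can be composed without losing the gain [1 - 2 * r]. *)
Definition sew_eps : R := (1 - 2 * r) / 5.
Local Notation eps := sew_eps.

Lemma half_pow_gt0 : 0 < r.
Proof. exact: powR_gt0. Qed.

Lemma half_pow_lt : r < 1 / 2.
Proof.
rewrite /half_pow powRN mul1r ltf_pV2 ?posrE ?powR_gt0//.
rewrite -[ltLHS](powRr1 (ler0n _ 2)) /powR.
rewrite pnatr_eq0 /= ltr_expR ltr_pM2r// ln_gt0// ltr1n//.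
Qed.

Lemma sew_epsE : 5 * eps = 1 - 2 * r.
Proof. by rewrite /sew_eps; lra. Qed.

Lemma sew_eps_gt0 : 0 < eps.
Proof. by have := sew_epsE; have := half_pow_lt; lra. Qed.

Lemma sew_eps_lt : eps < 1 / 5.
Proof. by have := sew_epsE; have := half_pow_gt0; lra. Qed.

Lemma powR_half (a t : R) : 0 <= a -> 2 * a <= t -> a `^ th <= r * t `^ th.
Proof.
move=> a0 at2; have t0 : 0 <= t by lra.
have th0 : 0 <= th by have := th1; lra.
have : (2 * a) `^ th <= t `^ th by apply: powR_mono => //; lra.
rewrite powRM// /half_pow powRN => H.
by rewrite -(ler_pM2l (powR_gt0 th (ltr0n _ 2))) mulrA divff ?mul1r// lt0r_neq0// powR_gt0.
Qed.

(** The interval from [p k] to [p k.+1] is the one that contains the midpoint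
    in time, so both remaining pieces have at most half the duration, whatever
    the partition. *)
Lemma bisect p n : grid T p -> (0 < n)%N -> exists k, [/\ (k < n)%N,
  (p k - p 0%N) `^ th <= r * (p n - p 0%N) `^ th &
  (p n - p k.+1) `^ th <= r * (p n - p 0%N) `^ th].
Proof.
move=> [hp pT] n0.
have p0n : p 0%N <= p n by apply: hp.
have [|||k [kn pk pk1]] := @grid_split p ((p 0%N + p n) / 2) n => //.
- by lra.
- by lra.
exists k; split => //; apply: powR_half.
- by rewrite subr_ge0 hp.
- by lra.
- by rewrite subr_ge0 hp.
- by lra.
Qed.

(** The recursions for the constants close: [q] stands for [half_pow], [e] for
    [sew_eps], and the total weight of [K] on the left is at most
    [1 - (1 - 2 * q) / 2]. *)
Lemma half_pow_arith (q e K M : R) : 0 < q -> q < 1 / 2 -> 5 * e = 1 - 2 * q ->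
  0 <= K -> 0 <= M -> K * (1 - 2 * q) = 6 * M ->
  K * (q * (1 + (1 + e) ^+ 2)) + M * (2 + e) <= K.
Proof.
move=> q0 q2 eE K0 M0 KE.
have e0 : 0 <= e by lra.
have ee : e * e <= e * 1 by apply: ler_wpM2l; lra.
have h1 : q * (1 + (1 + e) ^+ 2) <= q * (2 + 3 * e).
  by apply: ler_wpM2l; lra.
have h2 : q * e <= 1 / 2 * e by apply: ler_wpM2r; lra.
have h3 : K * (q * (1 + (1 + e) ^+ 2)) <= K * (1 - (1 - 2 * q) / 2).
  by apply: ler_wpM2l => //; lra.
have h4 : M * e <= M * 1 by apply: ler_wpM2l => //; lra.
by lra.
Qed.

Lemma half_pow_arith_lip (q e K C M : R) : 0 < q -> q < 1 / 2 ->
  5 * e = 1 - 2 * q -> 0 <= C -> 0 <= M -> 0 <= K ->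
  K * (1 - 2 * q) = 40 * C + 6 * M ->
  K * (q * (2 + 4 * e + e ^+ 2)) + C * (10 + 5 * e) + M * (2 + e) <= K.
Proof.
move=> q0 q2 eE C0 M0 K0 KE.
have e0 : 0 <= e by lra.
have ee : e * e <= e * 1 by apply: ler_wpM2l; lra.
have h1 : q * (2 + 4 * e + e ^+ 2) <= q * (2 + 5 * e).
  by apply: ler_wpM2l; lra.
have h2 : q * (5 * e) <= 1 / 2 * (5 * e) by apply: ler_wpM2r; lra.
have h3 : K * (q * (2 + 4 * e + e ^+ 2)) <= K * (1 - (1 - 2 * q) / 2).
  by apply: ler_wpM2l => //; lra.
have h4 : M * e <= M * 1 by apply: ler_wpM2l => //; lra.
have h5 : C * e <= C * 1 by apply: ler_wpM2l => //; lra.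
by lra.
Qed.

(** The errors met in the middle of a bisection are themselves below [e], so that
    two schemes stay within a factor [1 + 2 * e] of their initial distance. *)
Lemma lip_arith (q e K C M P : R) : 0 < q -> q < 1 / 2 ->
  5 * e = 1 - 2 * q -> 0 <= C -> 0 <= M -> 0 <= K -> 0 <= P ->
  (K + 5 * C + M) * P <= e ->
  K * P <= e /\ K * (q * P) <= e /\ ((1 + e) * (K * q) + 5 * C + M) * P <= e.
Proof.
move=> q0 q2 eE C0 M0 K0 P0 H.
have CP : 0 <= C * P by rewrite mulr_ge0.
have MP : 0 <= M * P by rewrite mulr_ge0.
have KP : 0 <= K * P by rewrite mulr_ge0.
have q1 : q * (K * P) <= 1 * (K * P) by rewrite ler_wpM2r//; lra.
have eq1 : (1 + e) * q * (K * P) <= 1 * (K * P).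
  rewrite ler_wpM2r//; have : (1 + e) * q <= (1 + 1) * q by rewrite ler_wpM2r//; lra.
  by lra.
by split; [|split]; lra.
Qed.

Variables (M h : R) (mu : R -> R -> V -> V).
Hypothesis M0 : 0 <= M.
Hypothesis mu_id : forall (s : R) (x : V), 0 <= s -> s <= T -> mu s s x = x.
Hypothesis mu_lip : forall (s t : R) (x y : V), 0 <= s -> s <= t -> t <= T -> t - s <= h ->
  `|(mu s t x - x) - (mu s t y - y)| <= eps * `|x - y|.
Hypothesis mu_defect : forall (s u t : R) (x : V), 0 <= s -> s <= u -> u <= t -> t <= T ->
  `|mu u t (mu s u x) - mu s t x| <= M * (t - s) `^ th.

Lemma mu_grid_lip p i j (x y : V) : grid T p -> (i <= j)%N -> p j - p i <= h ->
  `|mu (p i) (p j) x - mu (p i) (p j) y| <= (1 + eps) * `|x - y|.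
Proof.
move=> gp ij hij; have [i0 pij jT] := grid_le gp ij.
have -> : mu (p i) (p j) x - mu (p i) (p j) y =
  (x - y) + ((mu (p i) (p j) x - x) - (mu (p i) (p j) y - y)) by abel.
by rewrite mulrDl mul1r; apply: le_trans (ler_normD _ _) _; rewrite lerD2l mu_lip.
Qed.

Lemma mu_grid_defect p i j k (x : V) : grid T p -> (i <= j)%N -> (j <= k)%N ->
  `|mu (p j) (p k) (mu (p i) (p j) x) - mu (p i) (p k) x|
    <= M * (p k - p i) `^ th.
Proof.
move=> gp ij jk; have [i0 pij _] := grid_le gp ij; have [_ pjk kT] := grid_le gp jk.
exact: mu_defect.
Qed.

Definition sew_cst := 6 * M / (1 - 2 * r).
Local Notation KC := sew_cst.

Lemma sew_cstE : KC * (1 - 2 * r) = 6 * M.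
Proof.
by rewrite /sew_cst -mulrA mulVf ?mulr1// lt0r_neq0//; have := half_pow_lt; lra.
Qed.

Lemma sew_cst_ge0 : 0 <= KC.
Proof. by rewrite /sew_cst divr_ge0//; have := M0; have := half_pow_lt; lra. Qed.

(** Induction on the number of steps.  With [k] given by bisection, the scheme
    is a scheme up to [k], one exact step, and a scheme from [k.+1] on.  The
    two schemes are replaced by single steps at a cost of [KC * (r * P)] each,
    where [P] is the power of the whole duration, and the three single steps
    are merged into one at a cost of [M * P] per merge.  Smallness of [eps]
    lets [KC] absorb everything. *)
Lemma scheme_defect p x n : grid T p -> exact_scheme mu p x -> p n - p 0%N <= h ->
  `|x n - mu (p 0%N) (p n) (x 0%N)| <= KC * (p n - p 0%N) `^ th.
Proof.
have KC0 := sew_cst_ge0; have th0 : 0 <= th by have := th1; lra.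
elim/ltn_ind: n p x => -[|n] IH p x gp ex hh.
  have [_ pT] := gp; have /andP[? ?] := pT 0%N.
  by rewrite mu_id// subrr normr0 mulr_ge0// powR_ge0.
have [k [kn dl dr]] := @bisect p n.+1 gp isT.
have kn' := ltnW kn; have kk := leqnSn k.
have span i j (ij : (i <= j)%N) (jn : (j <= n.+1)%N) : p j - p i <= h :=
  le_trans (grid_span gp ij jn) hh.
set P := (p n.+1 - p 0%N) `^ th in dl dr *.
have i1 : `|x k - mu (p 0%N) (p k) (x 0%N)| <= KC * (r * P).
  by apply: le_trans (IH k kn p x gp ex (span _ _ _ kn')) _ => //; rewrite ler_wpM2l.
have i2 : `|x n.+1 - mu (p k.+1) (p n.+1) (x k.+1)| <= KC * (r * P).
  have := IH (n.+1 - k.+1)%N _ _ _ (grid_shift k.+1 gp) (exact_shift k.+1 ex).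
  rewrite addn0 subnKC// => H; apply: le_trans (H _ (span _ _ kn _)) _ => //.
    by rewrite subSS ltnS leq_subr.
  by rewrite ler_wpM2l.
have i3 : `|x k.+1 - mu (p 0%N) (p k.+1) (x 0%N)|
    <= (1 + eps) * (KC * (r * P)) + M * P.
  have -> : x k.+1 - mu (p 0%N) (p k.+1) (x 0%N) =
    (mu (p k) (p k.+1) (x k) - mu (p k) (p k.+1) (mu (p 0%N) (p k) (x 0%N)))
    + (mu (p k) (p k.+1) (mu (p 0%N) (p k) (x 0%N)) - mu (p 0%N) (p k.+1) (x 0%N)).
    by rewrite ex; abel.
  apply: le_trans (ler_normD _ _) _; apply: lerD.
    apply: le_trans (mu_grid_lip _ _ gp kk (span _ _ kk kn)) _.
    by rewrite ler_wpM2l// addr_ge0// ltW// sew_eps_gt0.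
  apply: le_trans (mu_grid_defect _ gp (leq0n k) kk) _.
  by rewrite ler_wpM2l// powR_mono ?subr_ge0 ?gp.1// (grid_span gp).
have i4 : `|mu (p k.+1) (p n.+1) (x k.+1) - mu (p k.+1) (p n.+1) (mu (p 0%N) (p k.+1) (x 0%N))|
   <= (1 + eps) * ((1 + eps) * (KC * (r * P)) + M * P).
  apply: le_trans (mu_grid_lip _ _ gp kn (span _ _ kn _)) _ => //.
  by rewrite ler_wpM2l// addr_ge0// ltW// sew_eps_gt0.
have i5 := mu_grid_defect (x 0%N) gp (leq0n k.+1) kn.
have -> : x n.+1 - mu (p 0%N) (p n.+1) (x 0%N) =
  (x n.+1 - mu (p k.+1) (p n.+1) (x k.+1)) +
  (mu (p k.+1) (p n.+1) (x k.+1) - mu (p k.+1) (p n.+1) (mu (p 0%N) (p k.+1) (x 0%N)))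
  + (mu (p k.+1) (p n.+1) (mu (p 0%N) (p k.+1) (x 0%N)) - mu (p 0%N) (p n.+1) (x 0%N)).
  by abel.
apply: le_trans (ler_normD _ _) _.
apply: le_trans (lerD (le_trans (ler_normD _ _) (lerD i2 i4)) i5) _.
rewrite -/P.
have -> : KC * (r * P) + (1 + eps) * ((1 + eps) * (KC * (r * P)) + M * P) + M * P
  = (KC * (r * (1 + (1 + eps) ^+ 2)) + M * (2 + eps)) * P by ring.
apply: ler_wpM2r; first exact: powR_ge0.
exact: half_pow_arith half_pow_gt0 half_pow_lt sew_epsE KC0 M0 sew_cstE.
Qed.

(** The four-point inequality replaces a Lipschitz bound on the derivative of
    the step. *)
Hypothesis mu_four : forall (s t : R) (a b c d : V),
  0 <= s -> s <= t -> t <= T -> t - s <= h ->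
  `|(mu s t a - a - (mu s t b - b)) - (mu s t c - c - (mu s t d - d))|
    <= eps * (`|a - b - (c - d)| + (`|a - b| + `|c - d|) * (`|a - c| + `|b - d|)).
Hypothesis mu_defect_lip : forall (s u t : R) (x y : V),
  0 <= s -> s <= u -> u <= t -> t <= T ->
  `|(mu u t (mu s u x) - mu s t x) - (mu u t (mu s u y) - mu s t y)|
    <= M * (t - s) `^ th * `|x - y|.

Definition lip_cst := (40 * KC + 6 * M) / (1 - 2 * r).
Local Notation KD := lip_cst.

Lemma lip_cstE : KD * (1 - 2 * r) = 40 * KC + 6 * M.
Proof.
by rewrite /lip_cst -mulrA mulVf ?mulr1// lt0r_neq0//; have := half_pow_lt; lra.
Qed.

Lemma lip_cst_ge0 : 0 <= KD.
Proof.
rewrite /lip_cst divr_ge0//; have := M0; have := half_pow_lt;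
have := sew_cst_ge0; lra.
Qed.

(** How the difference of two orbits propagates: [y - y'] is close to the
    difference of the single steps from [x] and [x'], and one further step
    preserves this.  The four-point inequality turns the sup norm distances of
    [y], [y'] to the single steps into a factor of the middle term. *)
Lemma mu_compare p i j k (x x' y y' : V) :
  grid T p -> (i <= j)%N -> (j <= k)%N -> p k - p j <= h ->
  `|(mu (p j) (p k) y - mu (p j) (p k) y') - (mu (p i) (p k) x - mu (p i) (p k) x')| <=
    (1 + eps) * `|(y - y') - (mu (p i) (p j) x - mu (p i) (p j) x')|
    + eps * ((`|y - mu (p i) (p j) x| + `|y' - mu (p i) (p j) x'|)
             * (`|y - y'| + `|mu (p i) (p j) x - mu (p i) (p j) x'|))
    + M * (p k - p i) `^ th * `|x - x'|.
Proof.
move=> gp ij jk hjk.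
have [i0 pij _] := grid_le gp ij; have [j0 pjk kT] := grid_le gp jk.
move: (p i) (p j) (p k) i0 pij j0 pjk kT hjk => s u t s0 su u0 ut tT hjk.
set a := mu s u x; set a' := mu s u x'.
have -> : (mu u t y - mu u t y') - (mu s t x - mu s t x') =
  ((mu u t y - y - (mu u t a - a)) - (mu u t y' - y' - (mu u t a' - a')))
  + (y - y' - (a - a')) + ((mu u t a - mu s t x) - (mu u t a' - mu s t x')).
  by abel.
have := @mu_four u t y a y' a' u0 ut tT hjk.
have -> : y - a - (y' - a') = y - y' - (a - a') by abel.
move=> h1; have h2 := @mu_defect_lip s u t x x' s0 su ut tT.
apply: le_trans (ler_normD _ _) _; apply: lerD h2.
apply: le_trans (ler_normD _ _) _.
apply: le_trans (lerD h1 (lexx _)) _.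
by rewrite le_eqVlt; apply/orP; left; apply/eqP; ring.
Qed.

Hypothesis h_small : forall t, 0 <= t -> t <= h ->
  (KD + 5 * KC + M) * t `^ th <= eps.

(** The same bisection as for [scheme_defect], now for the difference of two
    schemes; the sup norm estimate just proved controls the middle term of
    [mu_compare]. *)
Lemma scheme_defect_lip p x x' n : grid T p ->
  exact_scheme mu p x -> exact_scheme mu p x' -> p n - p 0%N <= h ->
  `|(x n - x' n) - (mu (p 0%N) (p n) (x 0%N) - mu (p 0%N) (p n) (x' 0%N))|
    <= KD * (p n - p 0%N) `^ th * `|x 0%N - x' 0%N|.
Proof.
have e0 := sew_eps_gt0; have KC0 := sew_cst_ge0; have KD0 := lip_cst_ge0.
have th0 : 0 <= th by have := th1; lra.
have e1 : 0 <= 1 + eps by rewrite addr_ge0// ltW.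
elim/ltn_ind: n p x x' => -[|n] IH p x x' gp ex ex' hh.
  have [_ pT] := gp; have /andP[? ?] := pT 0%N.
  by rewrite !mu_id// subrr normr0 mulr_ge0// mulr_ge0// powR_ge0.
have [k [kn dl dr]] := @bisect p n.+1 gp isT.
have kn' := ltnW kn; have kk := leqnSn k.
have span i j (ij : (i <= j)%N) (jn : (j <= n.+1)%N) : p j - p i <= h :=
  le_trans (grid_span gp ij jn) hh.
have mono i : (i <= n.+1)%N -> (p i - p 0%N) `^ th <= (p n.+1 - p 0%N) `^ th.
  by move=> ni; rewrite powR_mono ?subr_ge0 ?gp.1// (grid_span gp).
have P0 := powR_ge0 (p n.+1 - p 0%N) th.
have hs := h_small (_ : 0 <= p n.+1 - p 0%N) hh.
have {}hs : (KD + 5 * KC + M) * (p n.+1 - p 0%N) `^ th <= eps.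
  by apply: hs; rewrite subr_ge0 gp.1.
set P := (p n.+1 - p 0%N) `^ th in dl dr P0 hs mono.
have D0 := normr_ge0 (x 0%N - x' 0%N).
set D := `|x 0%N - x' 0%N| in D0 *.
have defect y i : exact_scheme mu p y -> (i <= n.+1)%N ->
    `|y i - mu (p 0%N) (p i) (y 0%N)| <= KC * P.
  move=> ey ni; apply: le_trans (scheme_defect gp ey (span _ _ _ ni)) _ => //.
  by rewrite ler_wpM2l// mono.
have muD q : (q <= n.+1)%N ->
    `|mu (p 0%N) (p q) (x 0%N) - mu (p 0%N) (p q) (x' 0%N)| <= (1 + eps) * D.
  by move=> nq; apply: mu_grid_lip; rewrite ?span.
have [KDP [KDr i2']] := lip_arith half_pow_gt0 half_pow_lt sew_epsE KC0 M0 KD0 P0 hs.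
have via i c : (i <= n.+1)%N ->
    `|(x i - x' i) - (mu (p 0%N) (p i) (x 0%N) - mu (p 0%N) (p i) (x' 0%N))| <= c * D ->
    c <= eps -> `|x i - x' i| <= (1 + 2 * eps) * D.
  move=> ni hc ce; rewrite -[x i - x' i](subrK (mu (p 0%N) (p i) (x 0%N) - mu (p 0%N) (p i) (x' 0%N))).
  apply: le_trans (ler_normD _ _) _; apply: le_trans (lerD hc (muD i ni)) _.
  by rewrite -mulrDl ler_wpM2r// (_ : 1 + 2 * eps = eps + (1 + eps)) ?lerD2r//; ring.
have cross i : (i <= n.+1)%N -> `|x i - x' i| <= (1 + 2 * eps) * D ->
    eps * ((`|x i - mu (p 0%N) (p i) (x 0%N)| + `|x' i - mu (p 0%N) (p i) (x' 0%N)|)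
           * (`|x i - x' i| + `|mu (p 0%N) (p i) (x 0%N) - mu (p 0%N) (p i) (x' 0%N)|))
    <= 5 * KC * P * D.
  move=> ni hi; have e5 := sew_eps_lt; have KPD : 0 <= KC * P * D by rewrite mulr_ge0// mulr_ge0.
  have H2 := lerD (defect x i ex ni) (defect x' i ex' ni).
  have H3 : `|x i - x' i| + `|mu (p 0%N) (p i) (x 0%N) - mu (p 0%N) (p i) (x' 0%N)| <= 4 * D.
    have eD : eps * D <= 1 / 5 * D by rewrite ler_wpM2r// ltW.
    apply: le_trans (lerD hi (muD i ni)) _; move: eD D0; lra.
  have H4 := ler_pM (addr_ge0 (normr_ge0 _) (normr_ge0 _)) (addr_ge0 (normr_ge0 _) (normr_ge0 _)) H2 H3.
  apply: le_trans (ler_wpM2l (ltW e0) H4) _.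
  have := ler_wpM2r KPD (ltW e5); move: KPD; lra.
(* from time 0 up to the bisection index *)
have i1 : `|(x k - x' k) - (mu (p 0%N) (p k) (x 0%N) - mu (p 0%N) (p k) (x' 0%N))|
    <= KD * (r * P) * D.
  apply: le_trans (IH k kn p x x' gp ex ex' (span _ _ _ kn')) _ => //.
  by rewrite ler_wpM2r// ler_wpM2l.
(* across the midpoint, where the scheme makes one exact step *)
have i2 : `|(x k.+1 - x' k.+1) - (mu (p 0%N) (p k.+1) (x 0%N) - mu (p 0%N) (p k.+1) (x' 0%N))|
    <= ((1 + eps) * (KD * r) + 5 * KC + M) * P * D.
  have MP : M * (p k.+1 - p 0%N) `^ th * D <= M * P * D.
    by rewrite ler_wpM2r// ler_wpM2l// mono.
  have c1 := cross k kn' (via k _ kn' i1 KDr).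
  rewrite !ex ex'; apply: le_trans (mu_compare _ _ _ _ gp (leq0n k) kk (span _ _ kk kn)) _.
  apply: le_trans (lerD (lerD (ler_wpM2l e1 i1) c1) MP) _.
  by rewrite le_eqVlt; apply/orP; left; apply/eqP; ring.
have j2 := via k.+1 _ kn i2 i2'.
(* from the end of that step on *)
have i3 : `|(x n.+1 - x' n.+1) - (mu (p k.+1) (p n.+1) (x k.+1) - mu (p k.+1) (p n.+1) (x' k.+1))|
    <= KD * (r * P) * ((1 + 2 * eps) * D).
  have := IH (n.+1 - k.+1)%N _ _ _ _ (grid_shift k.+1 gp) (exact_shift k.+1 ex) (exact_shift k.+1 ex').
  rewrite addn0 subnKC// => H; apply: le_trans (H _ (span _ _ kn _)) _ => //.
    by rewrite subSS ltnS leq_subr.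
  apply: ler_pM => //; last by rewrite ler_wpM2l.
  by rewrite mulr_ge0// powR_ge0.
rewrite -[x n.+1 - x' n.+1](subrK (mu (p k.+1) (p n.+1) (x k.+1) - mu (p k.+1) (p n.+1) (x' k.+1))) -addrA.
apply: le_trans (ler_normD _ _) _.
apply: le_trans (lerD i3 (mu_compare _ _ _ _ gp (leq0n k.+1) kn (span _ _ kn (leqnn _)))) _.
apply: le_trans (lerD (lexx _) (lerD (lerD (ler_wpM2l e1 i2) (cross _ kn j2)) (lexx _))) _.
rewrite -/P -/D.
have -> : KD * (r * P) * ((1 + 2 * eps) * D) +
  ((1 + eps) * (((1 + eps) * (KD * r) + 5 * KC + M) * P * D) +
   5 * KC * P * D + M * P * D) =
  (KD * (r * (2 + 4 * eps + eps ^+ 2)) + KC * (10 + 5 * eps) + M * (2 + eps)) * P * D by ring.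
apply: ler_wpM2r => //; apply: ler_wpM2r => //.
exact: half_pow_arith_lip half_pow_gt0 half_pow_lt sew_epsE KC0 M0 KD0 lip_cstE.
Qed.

Lemma scheme_lip p x x' n : grid T p ->
  exact_scheme mu p x -> exact_scheme mu p x' -> p n - p 0%N <= h ->
  `|x n - x' n| <= 2 * `|x 0%N - x' 0%N|.
Proof.
move=> gp ex ex' hh; have H := scheme_defect_lip gp ex ex' hh.
rewrite -[x n - x' n](subrK (mu (p 0%N) (p n) (x 0%N) - mu (p 0%N) (p n) (x' 0%N))).
apply: le_trans (ler_normD _ _) _.
apply: le_trans (lerD H (mu_grid_lip _ _ gp (leq0n n) hh)) _.
rewrite -mulrDl ler_wpM2r//.
have hs := h_small (_ : 0 <= p n - p 0%N) hh.
have {}hs : (KD + 5 * KC + M) * (p n - p 0%N) `^ th <= eps.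
  by apply: hs; rewrite subr_ge0 gp.1.
have [KDP _] := lip_arith half_pow_gt0 half_pow_lt sew_epsE sew_cst_ge0 M0
  lip_cst_ge0 (powR_ge0 _ _) hs.
have := sew_eps_lt; lra.
Qed.

(** Over long durations the bound 2 for durations up to [h] is iterated; a single
    step that leaves the window may be long, whence the factor [B]. *)
Lemma scheme_lip_iter (B : R) p x x' m n : 0 <= h -> 1 <= B ->
  (forall (s t : R) (a b : V), 0 <= s -> s <= t -> t <= T ->
    `|mu s t a - mu s t b| <= B * `|a - b|) ->
  grid T p -> exact_scheme mu p x -> exact_scheme mu p x' ->
  p n - p 0%N <= m%:R * h ->
  `|x n - x' n| <= 2 * (2 * B) ^+ m * `|x 0%N - x' 0%N|.
Proof.
move=> h0 B1 muB.
have B0 : 0 <= 2 * B by lra.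
elim: m n p x x' => [|m IH] n p x x' gp ex ex' hn.
  rewrite mul0r in hn.
  by rewrite expr0 mulr1; apply: (scheme_lip gp ex ex'); lra.
have [hp pT] := gp; have p0n : p 0%N <= p n by apply: hp.
have [nh|nh] := leP (p n - p 0%N) h.
  apply: le_trans (scheme_lip gp ex ex' nh) _.
  by rewrite ler_wpM2r// ler_peMr// exprn_ege1//; lra.
have n0 : (0 < n)%N by case: n nh {hn p0n} => //; rewrite subrr; lra.
have [||k [kn pk pk1]] := @grid_split p (p 0%N + h) n n0; try lra.
have /andP[pk0 _] := pT k; have /andP[_ pkT] := pT k.+1.
have pkk : p k <= p k.+1 by apply: hp.
have i1 : `|x k - x' k| <= 2 * `|x 0%N - x' 0%N| by apply: (scheme_lip gp ex ex'); lra.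
have i2 : `|x k.+1 - x' k.+1| <= B * (2 * `|x 0%N - x' 0%N|).
  rewrite ex ex'; apply: le_trans (muB _ _ _ _ pk0 pkk pkT) _.
  by rewrite ler_wpM2l//; lra.
have := IH (n - k.+1)%N _ _ _ (grid_shift k.+1 gp) (exact_shift k.+1 ex) (exact_shift k.+1 ex').
rewrite addn0 subnKC// => H; apply: le_trans (H _) _.
  by move: hn; rewrite -(natr1 m); lra.
rewrite exprSr.
apply: le_trans (ler_wpM2l _ i2) _; first by rewrite mulr_ge0// exprn_ge0.
by rewrite le_eqVlt; apply/orP; left; apply/eqP; ring.
Qed.

End Euler.

Section Flow.
Variables (R : realType) (V : normedModType R).
Implicit Types (p : nat -> R) (x y z : nat -> V) (mu : R -> R -> V -> V).

Fixpoint euler mu p (a : V) k : V :=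
  if k is j.+1 then mu (p j) (p j.+1) (euler mu p a j) else a.

Lemma euler_exact mu p a : exact_scheme mu p (euler mu p a).
Proof. by []. Qed.

Lemma euler_shift mu p a k : euler mu p a k.+1 =
  euler mu (fun i => p i.+1) (mu (p 0%N) (p 1%N) a) k.
Proof. by elim: k => //= k ->. Qed.

Definition stable_schemes T mu (L : R) := forall p x x' n, grid T p ->
  exact_scheme mu p x -> exact_scheme mu p x' ->
  `|x n - x' n| <= L * `|x 0%N - x' 0%N|.

(** Local errors add up.  The first step is peeled off: replacing [y 1] by the
    exact step from [y 0] changes the rest of the scheme by at most
    [L * e 0], by stability. *)
Lemma approx_scheme T mu L p y (e : nat -> R) n : 0 <= L ->
  stable_schemes T mu L -> grid T p ->
  (forall k, (k < n)%N -> `|y k.+1 - mu (p k) (p k.+1) (y k)| <= e k) ->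
  `|y n - euler mu p (y 0%N) n| <= L * \sum_(k < n) e k.
Proof.
move=> L0 stab; elim: n p y e => [|n IH] p y e gp ye.
  by rewrite subrr normr0 big_ord0 mulr0.
rewrite big_ord_recl mulrDr euler_shift.
have gp1 : grid T (fun i => p i.+1) := grid_shift 1 gp.
have -> : y n.+1 - euler mu (fun i => p i.+1) (mu (p 0%N) (p 1%N) (y 0%N)) n =
  (euler mu (fun i => p i.+1) (y 1%N) n -
   euler mu (fun i => p i.+1) (mu (p 0%N) (p 1%N) (y 0%N)) n) +
  (y n.+1 - euler mu (fun i => p i.+1) (y 1%N) n) by abel.
apply: le_trans (ler_normD _ _) _; apply: lerD.
  apply: le_trans (stab _ _ _ _ gp1 (@euler_exact _ _ _) (@euler_exact _ _ _)) _.
  by rewrite ler_wpM2l// ye.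
by apply: (IH _ (fun i => y i.+1) (fun i => e i.+1)) => // k kn; apply: ye.
Qed.

(** The four clauses after the first are, in order: the step is close to the
    identity in Lipschitz norm and for four-point differences, and two
    consecutive steps are close to one step in sup norm and in Lipschitz norm. *)
Definition lipschitz_almost_flow (T th b M : R) mu := [/\
  forall (s : R) (x : V), 0 <= s -> s <= T -> mu s s x = x,
  forall (s t : R) (x y : V), 0 <= s -> s <= t -> t <= T ->
    `|(mu s t x - x) - (mu s t y - y)| <= M * (t - s) `^ b * `|x - y|,
  forall (s t : R) (x y x' y' : V), 0 <= s -> s <= t -> t <= T ->
    `|(mu s t x - x - (mu s t y - y)) - (mu s t x' - x' - (mu s t y' - y'))|
    <= M * (t - s) `^ b * (`|x - y - (x' - y')|
        + (`|x - y| + `|x' - y'|) * (`|x - x'| + `|y - y'|)),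
  forall (s u t : R) (x : V), 0 <= s -> s <= u -> u <= t -> t <= T ->
    `|mu u t (mu s u x) - mu s t x| <= M * (t - s) `^ th &
  forall (s u t : R) (x y : V), 0 <= s -> s <= u -> u <= t -> t <= T ->
    `|(mu u t (mu s u x) - mu s t x) - (mu u t (mu s u y) - mu s t y)|
    <= M * (t - s) `^ th * `|x - y|].

(** Uniform control of all Euler schemes: the window [h] is chosen so small
    that the smallness conditions of the preceding section hold. *)
Lemma almost_flow_schemes T th b M mu : 1 < th -> 0 < b -> 0 <= T -> 0 <= M ->
  lipschitz_almost_flow T th b M mu ->
  exists h K L, [/\ 0 < h, 0 <= K, 0 <= L, stable_schemes T mu L &
    forall p x n, grid T p -> exact_scheme mu p x -> p n - p 0%N <= h ->
      `|x n - mu (p 0%N) (p n) (x 0%N)| <= K * (p n - p 0%N) `^ th].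
Proof.
move=> th1 b0 T0 M0 [mu_id mu_lip mu_four mu_def mu_defl].
have e0 : 0 < sew_eps th := sew_eps_gt0 th1.
have th0 : 0 < th by lra.
have [h1 h10 Hh1] := powR_small M b0 e0.
have [h2 h20 Hh2] := powR_small (lip_cst th M + 5 * sew_cst th M + M) th0 e0.
pose h := Num.min h1 h2.
have h0 : 0 < h by rewrite lt_min h10.
have small (t : R) : 0 <= t -> t <= h -> M * t `^ b <= sew_eps th.
  by move=> t0; rewrite le_min => /andP[th1' _]; exact: Hh1.
have lip (s t : R) (x y : V) : 0 <= s -> s <= t -> t <= T -> t - s <= h ->
  `|(mu s t x - x) - (mu s t y - y)| <= sew_eps th * `|x - y|.
  move=> s0 st tT sth; apply: le_trans (mu_lip _ _ _ _ s0 st tT) _.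
  by rewrite ler_wpM2r// small// subr_ge0.
have four (s t : R) (a a' c c' : V) : 0 <= s -> s <= t -> t <= T -> t - s <= h ->
  `|(mu s t a - a - (mu s t a' - a')) - (mu s t c - c - (mu s t c' - c'))|
    <= sew_eps th * (`|a - a' - (c - c')| + (`|a - a'| + `|c - c'|) * (`|a - c| + `|a' - c'|)).
  move=> s0 st tT sth; apply: le_trans (mu_four _ _ _ _ _ _ s0 st tT) _.
  by rewrite ler_wpM2r ?small ?subr_ge0// addr_ge0// mulr_ge0.
have hs (t : R) : 0 <= t -> t <= h -> (lip_cst th M + 5 * sew_cst th M + M) * t `^ th <= sew_eps th.
  by move=> t0; rewrite le_min => /andP[_ th2']; exact: Hh2.
pose B := 1 + M * T `^ b.
have B1 : 1 <= B by rewrite lerDl mulr_ge0// powR_ge0.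
have muB (s t : R) (x y : V) : 0 <= s -> s <= t -> t <= T -> `|mu s t x - mu s t y| <= B * `|x - y|.
  move=> s0 st tT.
  have -> : mu s t x - mu s t y = (x - y) + ((mu s t x - x) - (mu s t y - y)) by abel.
  apply: le_trans (ler_normD _ _) _.
  rewrite mulrDl mul1r lerD2l; apply: le_trans (mu_lip _ _ _ _ s0 st tT) _.
  by rewrite ler_wpM2r// ler_wpM2l// powR_mono//; lra.
pose m := Num.bound (T / h).
have mh : T <= m%:R * h.
  rewrite -ler_pdivrMr//; apply: ltW; apply: archi_boundP.
  by rewrite divr_ge0// ltW.
exists h, (sew_cst th M), (2 * (2 * B) ^+ m); split => //.
- exact: sew_cst_ge0.
- by rewrite mulr_ge0// exprn_ge0//; lra.
- move=> p x x' n gp ex ex'.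
  apply: (scheme_lip_iter th1 M0 mu_id lip mu_def four mu_defl hs (ltW h0) B1 muB gp ex ex').
  have [_ pT] := gp; have /andP[? _] := pT 0%N; have /andP[_ ?] := pT n.
  by lra.
- by move=> p x n; apply: (scheme_defect th1 M0 mu_id lip mu_def).
Qed.

End Flow.

(** * Paths driven by an almost flow *)

(** Joins the complete and the normed structures of matrices. *)
HB.instance Definition _ (R : realType) (m n : nat) := Complete.on 'M[R]_(m, n).

Section ClippedGrids.
Variable R : realType.
Implicit Types (T s t : R) (f : nat -> R).

Definition dyadic T N k : R := k%:R * (T / 2 ^+ N).

Lemma dyadic_nd T N : 0 <= T ->
  {homo dyadic T N : i j / (i <= j)%N >-> i <= j}.
Proof.
move=> T0 i j ij; rewrite /dyadic ler_wpM2r ?ler_nat//.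
by rewrite divr_ge0// exprn_ge0.
Qed.

Lemma dyadic0 T N : dyadic T N 0 = 0. Proof. exact: mul0r. Qed.

Lemma dyadic_last T N : dyadic T N (2 ^ N) = T.
Proof.
by rewrite /dyadic natrX mulrC divfK// expf_neq0.
Qed.

Lemma dyadicS T N k : dyadic T N k.+1 = dyadic T N k + T / 2 ^+ N.
Proof. by rewrite /dyadic -natr1 mulrDl mul1r. Qed.

Lemma dyadic_refine T N k : dyadic T N.+1 k.*2 = dyadic T N k.
Proof.
have e0 : 2 ^+ N != 0 :> R by rewrite expf_neq0.
by rewrite /dyadic -muln2 natrM exprS; field.
Qed.

(** The dyadic partition clipped to [s, t]: constant outside, so that its
    points keep the dyadic indices. *)
Definition clip s t f k := Num.max (Num.min (f k) t) s.

Lemma clip_grid T s t f : 0 <= s -> s <= t -> t <= T ->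
  {homo f : i j / (i <= j)%N >-> i <= j} -> grid T (clip s t f).
Proof.
move=> s0 st tT fnd; split=> [i j ij|k].
  rewrite /clip ge_max !le_max lexx orbT andbT.
  by rewrite le_min !ge_min lexx (fnd _ _ ij) !orbT.
rewrite /clip le_max s0 orbT ge_max ge_min tT orbT.
exact: le_trans st tT.
Qed.

Lemma clip_step T t N k : 0 <= t -> 0 <= T ->
  clip 0 t (dyadic T N) k.+1 - clip 0 t (dyadic T N) k <= T / 2 ^+ N.
Proof.
move=> t0 T0; rewrite /clip dyadicS.
have d0 : 0 <= dyadic T N k by rewrite -(dyadic0 T N) dyadic_nd.
have e0 : 0 <= T / 2 ^+ N by rewrite divr_ge0// exprn_ge0.
rewrite !(max_idPl _) ?le_min ?t0 ?addr_ge0// ?d0//.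
by case: (leP (dyadic T N k + _)) => ?; case: (leP (dyadic T N k)) => ?; lra.
Qed.

End ClippedGrids.

Section Existence.
Variables (R : realType) (V : normedModType R) (T th b M L : R).
Variable mu : R -> R -> V -> V.
Hypotheses (th1 : 1 < th) (T0 : 0 <= T) (M0 : 0 <= M) (L0 : 0 <= L).
Hypothesis mu_flow : lipschitz_almost_flow T th b M mu.
Hypothesis mu_stable : stable_schemes T mu L.

Local Notation q := (2 * half_pow th).

Lemma ratio_lt1 : 0 <= q /\ q < 1.
Proof. by have := half_pow_gt0 th; have := half_pow_lt th1; split; lra. Qed.

(** [2 ^ N] local errors of order [th > 1] sum up to a geometric sequence. *)
Lemma dyadic_error (C : R) N :
  \sum_(k < 2 ^ N) (C * (T / 2 ^+ N) `^ th) = C * T `^ th * q ^+ N.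
Proof.
have E : (T / 2 ^+ N) `^ th = T `^ th * half_pow th ^+ N.
  elim: N => [|N IH]; first by rewrite !expr0 divr1 mulr1.
  rewrite !exprS invfM mulrCA powRM ?invr_ge0 ?divr_ge0 ?exprn_ge0// IH.
  rewrite mulrCA; congr (_ * (_ * _)).
  by rewrite /half_pow -powR_inv1// -powRrM mulN1r.
by rewrite E sumr_const card_ord -[LHS]mulr_natr natrX exprMn; ring.
Qed.

(** The value at time [t] of the Euler approximation of level [N]. *)
Definition polygon xi N t := euler mu (clip 0 t (dyadic T N)) xi (2 ^ N)%N.

(** The scheme of level [N.+1], read at even indices, is an approximate scheme
    of level [N]: its local errors are the defects of two half steps. *)
Lemma polygon_cauchy xi N t : 0 <= t -> t <= T ->
  `|polygon xi N.+1 t - polygon xi N t| <= L * (M * T `^ th) * q ^+ N.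
Proof.
move=> t0 tT; rewrite -mulrA -dyadic_error.
have [_ _ _ mu_def _] := mu_flow.
have nd := dyadic_nd _ T0.
have gp := clip_grid (lexx 0) t0 tT (nd N).
have [hp' pT'] := clip_grid (lexx 0) t0 tT (nd N.+1).
rewrite /polygon expnS mul2n.
pose y k := euler mu (clip 0 t (dyadic T N.+1)) xi k.*2.
apply: (@approx_scheme _ _ T mu L _ y (fun=> _)) => // k kN.
have -> : clip 0 t (dyadic T N) k = clip 0 t (dyadic T N.+1) k.*2.
  by rewrite /clip dyadic_refine.
have E : clip 0 t (dyadic T N) k.+1 = clip 0 t (dyadic T N.+1) k.*2.+2.
  by rewrite /clip -doubleS dyadic_refine.
rewrite E /y doubleS /=; set p := clip 0 t (dyadic T N.+1) in hp' pT' *.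
have /andP[p0 _] := pT' k.*2; have /andP[_ pT2] := pT' k.*2.+2.
apply: le_trans (mu_def _ _ _ _ p0 (hp' _ _ _) (hp' _ _ _) pT2) _ => //.
apply: ler_wpM2l => //; apply: powR_mono; first by have := th1; lra.
  by rewrite subr_ge0; apply: hp'; rewrite leqW.
rewrite /p -E; have -> : clip 0 t (dyadic T N.+1) k.*2 = clip 0 t (dyadic T N) k.
  by rewrite /clip dyadic_refine.
exact: clip_step.
Qed.

Lemma polygon_cell xi N k t : t <= T -> (k < 2 ^ N)%N ->
  dyadic T N k <= t -> t <= dyadic T N k.+1 ->
  polygon xi N t = mu (dyadic T N k) t (euler mu (dyadic T N) xi k).
Proof.
move=> tT kN kt tk; have [mu_id _ _ _ _] := mu_flow.
have nd := dyadic_nd N T0.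
have d0 i : 0 <= dyadic T N i by rewrite -(dyadic0 T N) nd.
have t0 : 0 <= t := le_trans (d0 k) kt.
have below i : (i <= k)%N -> clip 0 t (dyadic T N) i = dyadic T N i.
  move=> ik; rewrite /clip (min_idPl _) ?(max_idPl _)//.
  exact: le_trans (nd _ _ ik) kt.
have above i : (k < i)%N -> clip 0 t (dyadic T N) i = t.
  move=> ki; rewrite /clip (min_idPr _) ?(max_idPl _)//.
  exact: le_trans tk (nd _ _ ki).
have init i : (i <= k)%N -> euler mu (clip 0 t (dyadic T N)) xi i
    = euler mu (dyadic T N) xi i.
  elim: i => // i IH ik; have ik' := ltnW ik.
  by rewrite [LHS]/= IH// !below.
have final i : euler mu (clip 0 t (dyadic T N)) xi (k.+1 + i)%N
    = mu (dyadic T N k) t (euler mu (dyadic T N) xi k).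
  elim: i => [|i IH]; first by rewrite addn0 /= init// below// above.
  have ki : (k < k.+1 + i)%N by rewrite addSn ltnS leq_addr.
  by rewrite addnS (euler_exact _ _ _ (k.+1 + i)%N) IH !above ?mu_id// ltnW.
by rewrite /polygon -(subnKC kN) final.
Qed.

Lemma polygon_cell_defect xi N k s t : (k < 2 ^ N)%N ->
  dyadic T N k <= s -> s <= t -> t <= dyadic T N k.+1 ->
  `|polygon xi N t - mu s t (polygon xi N s)| <= M * (T / 2 ^+ N) `^ th.
Proof.
move=> kN ks st tk; have [_ _ _ mu_def _] := mu_flow.
have dT : dyadic T N k.+1 <= T.
  by rewrite -[leRHS](dyadic_last T N); apply: dyadic_nd.
have tT := le_trans tk dT.
rewrite (polygon_cell xi tT kN (le_trans ks st) tk).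
rewrite (polygon_cell xi (le_trans st tT) kN ks (le_trans st tk)) distrC.
have nd := dyadic_nd N T0.
have d0 : 0 <= dyadic T N k by rewrite -(dyadic0 T N) nd.
apply: le_trans (mu_def _ _ _ _ d0 ks st tT) _.
apply: ler_wpM2l => //; apply: powR_mono; first by have := th1; lra.
  by lra.
by move: tk; rewrite dyadicS; lra.
Qed.

(** The approximation restarted at an arbitrary time [s] is an approximate scheme
    along the clipped partition; this is what makes the limit a Davie path from
    all [s], not only from dyadic ones. *)
Lemma polygon_scheme xi N s t : 0 <= s -> s <= t -> t <= T ->
  `|polygon xi N t - euler mu (clip s t (dyadic T N)) (polygon xi N s) (2 ^ N)%N|
    <= L * (M * T `^ th) * q ^+ N.
Proof.
move=> s0 st tT; rewrite -mulrA -dyadic_error.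
have [mu_id _ _ _ _] := mu_flow.
have nd := dyadic_nd N T0.
have gp := clip_grid s0 st tT nd.
pose y k := polygon xi N (clip s t (dyadic T N) k).
have y0 : y 0%N = polygon xi N s.
  by rewrite /y /clip dyadic0 (min_idPl _) ?(max_idPr _)// (le_trans s0).
have yN : y (2 ^ N)%N = polygon xi N t.
  by rewrite /y /clip dyadic_last (min_idPr _) ?(max_idPl _).
rewrite -y0 -yN; apply: (@approx_scheme _ _ T mu L _ y (fun=> _)) => // k kN.
have err0 : 0 <= M * (T / 2 ^+ N) `^ th by rewrite mulr_ge0// powR_ge0.
rewrite /y; have [hk|hk] := leP (dyadic T N k.+1) s.
  have -> : clip s t (dyadic T N) k.+1 = s.
    by rewrite /clip (max_idPr _)// ge_min hk.
  have -> : clip s t (dyadic T N) k = s.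
    rewrite /clip (max_idPr _)// ge_min (le_trans _ hk)//; exact: nd.
  by rewrite mu_id ?(le_trans st)// subrr normr0.
have [hk'|hk'] := leP t (dyadic T N k).
  have -> : clip s t (dyadic T N) k.+1 = t.
    rewrite /clip (min_idPr _) ?(max_idPl _)// (le_trans hk')//; exact: nd.
  have -> : clip s t (dyadic T N) k = t.
    by rewrite /clip (min_idPr _) ?(max_idPl _).
  by rewrite mu_id ?(le_trans s0)// subrr normr0.
have [hp pT] := gp.
apply: (polygon_cell_defect _ kN); last 2 first.
- exact: hp.
- by rewrite /clip ge_max ge_min lexx (ltW hk).
- by rewrite /clip le_max le_min lexx (ltW hk').
Qed.

End Existence.

Lemma geometric_cvg (R : realType) (V : completeNormedModType R)
    (u : nat -> V) (C q : R) : 0 <= q -> q < 1 ->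
  (forall n, `|u n.+1 - u n| <= C * q ^+ n) -> cvgn u.
Proof.
move=> q0 q1 H.
suff : cvgn (series (telescope u)).
  rewrite telescopeK => cv.
  have -> : u = (fun n => (u n - u 0%N) + u 0%N) by apply/funext => n; rewrite subrK.
  by apply: is_cvgD => //; exact: is_cvg_cst.
apply: normed_cvg; apply: (@series_le_cvg _ _ (geometric C q)) => //.
- by move=> n; exact: normr_ge0.
- by move=> n; apply: le_trans (normr_ge0 _) (H n).
- by apply: is_cvg_geometric_series; rewrite ger0_norm.
Qed.

Lemma le_by_cvg (R : realType) (a : R) (c : nat -> R) (A : R) :
  (forall n, a <= A + c n) -> (c @ \oo --> 0)%classic -> a <= A.
Proof.
move=> H c0.
have : ((fun n => A + c n) @ \oo --> A + 0)%classic.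
  by apply: cvgD => //; exact: cvg_cst.
rewrite addr0 => cv; rewrite -(cvg_lim _ cv)//.
apply: limr_ge; first by apply/cvg_ex; exists A.
by apply: nearW.
Qed.

Section DaviePaths.
Variables (R : realType) (V : completeNormedModType R) (T th b M : R).
Variable mu : R -> R -> V -> V.
Hypotheses (th1 : 1 < th) (b0 : 0 < b) (T0 : 0 <= T) (M0 : 0 <= M).
Hypothesis mu_flow : lipschitz_almost_flow T th b M mu.

Definition davie_path (z : R -> V) (h C : R) := forall s t : R,
  0 <= s -> s <= t -> t <= T -> t - s <= h ->
  `|z t - mu s t (z s)| <= C * (t - s) `^ th.

(** The limit of the polygons is a Davie path: the polygon is close to its
    restart at [s], and [scheme_defect] compares the restarted scheme with the
    single step from [s] to [t]. *)
Lemma almost_flow_exists (xi : V) : exists z h C,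
  [/\ 0 < h, 0 <= C, z 0 = xi & davie_path z h C].
Proof.
have [h [K [L [h0 K0 L0 stab sch]]]] := almost_flow_schemes th1 b0 T0 M0 mu_flow.
have [q0 q1] := ratio_lt1 th1.
have cvz t : 0 <= t -> t <= T -> cvgn (fun N => polygon T mu xi N t).
  move=> t0 tT; apply: geometric_cvg q0 q1 _ => N.
  exact: polygon_cauchy th1 T0 M0 L0 mu_flow stab xi N t t0 tT.
have [mu_id mu_lip _ _ _] := mu_flow.
pose z (t : R) : V := lim (polygon T mu xi N t @[N --> \oo])%classic.
exists z, h, K; split => //.
  have E N : polygon T mu xi N 0 = xi.
    have d1 : dyadic T N 0 <= 0 by rewrite dyadic0.
    have d2 : 0 <= dyadic T N 1 by rewrite -(dyadic0 T N); apply: dyadic_nd.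
    by rewrite (polygon_cell T0 mu_flow xi T0 _ d1 d2) ?expn_gt0// dyadic0 mu_id.
  by rewrite /z; apply: cvg_lim => //; under eq_fun do rewrite E; exact: cvg_cst.
move=> s t s0 st tT sth.
have cs : (polygon T mu xi N s @[N --> \oo] --> z s)%classic.
  exact: cvz s s0 (le_trans st tT).
have ct : (polygon T mu xi N t @[N --> \oo] --> z t)%classic.
  exact: cvz t (le_trans s0 st) tT.
move: (z s) (z t) cs ct => zs zt cs ct.
pose B := 1 + M * (t - s) `^ b.
have B0 : 0 <= B by rewrite addr_ge0// mulr_ge0// powR_ge0.
have muB x y : `|mu s t x - mu s t y| <= B * `|x - y|.
  have -> : mu s t x - mu s t y = (x - y) + ((mu s t x - x) - (mu s t y - y)) by abel.
  apply: le_trans (ler_normD _ _) _.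
  by rewrite mulrDl mul1r lerD2l; apply: mu_lip.
apply: (@le_by_cvg _ _ (fun N => `|zt - polygon T mu xi N t| +
   (L * (M * T `^ th) * (2 * half_pow th) ^+ N + B * `|polygon T mu xi N s - zs|))).
  move=> N.
  have gp := clip_grid s0 st tT (dyadic_nd N T0).
  have p0 : clip s t (dyadic T N) 0%N = s.
    by rewrite /clip dyadic0 (min_idPl _) ?(max_idPr _)// (le_trans s0).
  have pN : clip s t (dyadic T N) (2 ^ N)%N = t.
    by rewrite /clip dyadic_last (min_idPr _) ?(max_idPl _).
  have H1 := polygon_scheme th1 T0 M0 L0 mu_flow stab xi N s0 st tT.
  have := sch _ _ (2 ^ N)%N gp (@euler_exact _ _ mu _ (polygon T mu xi N s)).
  rewrite p0 pN => /(_ sth) /= H2.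
  have H3 := muB (polygon T mu xi N s) zs.
  set e := euler _ _ _ _ in H1 H2.
  have -> : zt - mu s t zs = (zt - polygon T mu xi N t) +
    ((polygon T mu xi N t - e) + ((e - mu s t (polygon T mu xi N s)) +
     (mu s t (polygon T mu xi N s) - mu s t zs))) by abel.
  apply: le_trans (ler_normD _ _) _.
  apply: le_trans (lerD (lexx _) (ler_normD _ _)) _.
  apply: le_trans (lerD (lexx _) (lerD H1 (ler_normD _ _))) _.
  by lra.
have -> : 0 = `|zt - zt| + (L * (M * T `^ th) * 0 + B * `|zs - zs|) :> R.
  by rewrite !subrr !normr0 !mulr0 !addr0.
apply: cvgD; first by apply: cvg_norm; apply: cvgB ct; exact: cvg_cst.
apply: cvgD.
  apply: cvgMr; apply: cvg_expr; by rewrite ger0_norm.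
apply: cvgMr; apply: cvg_norm; apply: cvgB => //; exact: cvg_cst.
Qed.

(** Both paths are approximate schemes along the dyadic partitions, with local
    errors of order [th], hence are limits of the same exact schemes. *)
Lemma almost_flow_unique (z z' : R -> V) h h' C C' :
  0 < h -> 0 < h' -> davie_path z h C -> davie_path z' h' C' ->
  z 0 = z' 0 -> forall t, 0 <= t -> t <= T -> z t = z' t.
Proof.
move=> h0 h'0 dz dz' z0 t t0 tT.
have [g [K [L [g0 K0 L0 stab _]]]] := almost_flow_schemes th1 b0 T0 M0 mu_flow.
have [q0 q1] := ratio_lt1 th1.
pose m := Num.bound (T / Num.min h h').
have hm N : T / 2 ^+ (m + N) <= Num.min h h'.
  have hh : 0 < Num.min h h' by rewrite lt_min h0.
  rewrite ler_pdivrMr ?exprn_gt0// mulrC -ler_pdivrMr//.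
  apply: le_trans (ltW (archi_boundP _)) _; first by rewrite divr_ge0// ltW.
  by rewrite -natrX ler_nat (leq_trans (leq_addr N m))// ltnW// ltn_expl.
have close y C0 h1 N : T / 2 ^+ N <= h1 -> davie_path y h1 C0 ->
    `|y t - euler mu (clip 0 t (dyadic T N)) (y 0) (2 ^ N)%N|
      <= L * (`|C0| * T `^ th) * (2 * half_pow th) ^+ N.
  move=> Nh dy.
  have nd := dyadic_nd N T0; have gp := clip_grid (lexx 0) t0 tT nd.
  have [hp pT] := gp.
  rewrite -mulrA -(dyadic_error th T0).
  pose Y k := y (clip 0 t (dyadic T N) k).
  have Y0 : Y 0%N = y 0 by rewrite /Y /clip dyadic0 (min_idPl _)// maxxx.
  have YN : Y (2 ^ N)%N = y t.
    by rewrite /Y /clip dyadic_last (min_idPr _) ?(max_idPl _).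
  rewrite -Y0 -YN; apply: (@approx_scheme _ _ T mu L _ Y (fun=> _)) => // k kN.
  have step : clip 0 t (dyadic T N) k.+1 - clip 0 t (dyadic T N) k <= T / 2 ^+ N.
    exact: clip_step.
  have kk : clip 0 t (dyadic T N) k <= clip 0 t (dyadic T N) k.+1 by apply: hp.
  have /andP[k0 _] := pT k; have /andP[_ kT] := pT k.+1.
  apply: le_trans (dy _ _ k0 kk kT (le_trans step Nh)) _.
  apply: le_trans (ler_wpM2r (powR_ge0 _ _) (ler_norm C0)) _.
  apply: ler_wpM2l => //; apply: powR_mono => //; last by rewrite subr_ge0.
  by have := th1; lra.
apply/eqP; rewrite -subr_eq0 -normr_le0.
have cv0 C0 : ((fun N => L * (C0 * T `^ th) * (2 * half_pow th) ^+ (m + N)) @ \oo --> 0)%classic.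
  under eq_fun do rewrite exprD mulrA.
  have -> : 0 = L * (C0 * T `^ th) * (2 * half_pow th) ^+ m * 0 :> R by rewrite mulr0.
  by apply: cvgMr; apply: cvg_expr; rewrite ger0_norm.
pose c N : R := L * (`|C| * T `^ th) * (2 * half_pow th) ^+ (m + N)
  + L * (`|C'| * T `^ th) * (2 * half_pow th) ^+ (m + N).
have cv : (c @ \oo --> 0)%classic.
  have -> : 0 = 0 + 0 :> R by rewrite addr0.
  by apply: cvgD; exact: cv0.
apply: (@le_by_cvg _ _ c) => // N; rewrite add0r /c.
have := hm N; rewrite le_min => /andP[Hh Hh'].
have := lerD (close z _ _ _ Hh dz) (close z' _ _ _ Hh' dz').
rewrite z0; set e := euler _ _ _ _ => H; apply: le_trans H.
have -> : z t - z' t = (z t - e) - (z' t - e) by abel.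
exact: ler_normB.
Qed.

End DaviePaths.

(** * Functions with a bounded Lipschitz derivative *)

Section MatrixNorm.
Variable R : realType.

Lemma mx_entry_le m n (A : 'M[R]_(m, n)) i j : `|A i j| <= `|A|.
Proof.
rewrite [leRHS]/Num.norm/= mx_normrE.
exact: (le_bigmax_cond _ (fun ij => `|A ij.1 ij.2|) (isT : xpredT (i, j))).
Qed.

Lemma mx_norm_le m n (A : 'M[R]_(m, n)) (C : R) : 0 <= C ->
  (forall i j, `|A i j| <= C) -> `|A| <= C.
Proof.
move=> C0 H; rewrite [leLHS]/Num.norm/= mx_normrE.
by apply: bigmax_le => // -[i j] _; exact: H.
Qed.

Lemma mulmx_norm m n p (A : 'M[R]_(m, n)) (B : 'M[R]_(n, p)) :
  `|A *m B| <= n%:R * (`|A| * `|B|).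
Proof.
apply: mx_norm_le => [|i j]; first by rewrite mulr_ge0// mulr_ge0.
rewrite !mxE; apply: le_trans (ler_norm_sum _ _ _) _.
apply: le_trans (_ : \sum_(k < n) (`|A| * `|B|) <= _); last first.
  by rewrite sumr_const card_ord mulr_natl.
by apply: ler_sum => k _; rewrite normrM ler_pM// mx_entry_le.
Qed.

Lemma mulmx_le m n p (A : 'M[R]_(m, n)) (B : 'M[R]_(n, p)) a b :
  `|A| <= a -> `|B| <= b -> `|A *m B| <= n%:R * (a * b).
Proof.
by move=> Aa Bb; apply: le_trans (mulmx_norm _ _) _; rewrite ler_wpM2l// ler_pM.
Qed.

Lemma cV_basis n (v : 'cV[R]_n) : v = \sum_(k < n) v k 0 *: delta_mx k 0.
Proof.
apply/matrixP => i j; rewrite summxE (bigD1 i)//= big1 ?addr0; last first.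
  by move=> k ki; rewrite !mxE eq_sym (negPf ki) mulr0.
by rewrite !mxE !ord1 !eqxx mulr1.
Qed.

Lemma linear_basis n (E : lmodType R) (f : {linear 'cV[R]_n -> E}) v :
  f v = \sum_(k < n) v k 0 *: f (delta_mx k 0).
Proof.
by rewrite {1}(cV_basis v) linear_sum; apply: eq_bigr => k _; rewrite linearZ.
Qed.

Lemma norm_comb_le (E : normedModType R) (I : finType) (a : I -> R) (f : I -> E)
    (A B : R) (m : I -> R) : 0 <= B -> (forall i, `|a i| <= A) ->
  (forall i, `|f i| <= m i * B) ->
  `|\sum_i a i *: f i| <= A * ((\sum_i m i) * B).
Proof.
move=> B0 aA fm; apply: le_trans (ler_norm_sum _ _ _) _.
rewrite mulr_suml mulr_sumr; apply: ler_sum => i _.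
by rewrite normrZ; apply: ler_pM.
Qed.

Lemma linear_sub_le n (E : normedModType R) (f g : {linear 'cV[R]_n -> E})
    (m : 'I_n -> R) B v : 0 <= B ->
  (forall k, `|f (delta_mx k 0) - g (delta_mx k 0)| <= m k * B) ->
  `|f v - g v| <= `|v| * ((\sum_k m k) * B).
Proof.
move=> B0 H; rewrite (linear_basis f) (linear_basis g) -sumrB.
under eq_bigr do rewrite -scalerBr.
by apply: norm_comb_le => // k; exact: mx_entry_le.
Qed.

End MatrixNorm.

Section C11.
Variables (R : realType) (V : normedModType R).

(** The natural bound for a second order difference of a function with bounded
    Lipschitz derivative: the difference of the increments [a - b], [c - e],
    plus their sizes times the distance between the two segments. *)
Definition four_point (a b c e : V) : R :=
  `|a - b - (c - e)| + (`|a - b| + `|c - e|) * (`|a - c| + `|b - e|).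

Lemma four_point_ge0 a b c e : 0 <= four_point a b c e.
Proof. by rewrite addr_ge0// mulr_ge0// addr_ge0. Qed.

Definition C11_with (E : normedModType R) (f : V -> E) (K : R) := [/\
  forall x, `|f x| <= K, forall x y, `|f x - f y| <= K * `|x - y| &
  forall a b c e, `|f a - f b - (f c - f e)| <= K * four_point a b c e].

Definition C11 (E : normedModType R) (f : V -> E) :=
  exists2 K : R, 0 <= K & C11_with f K.

Lemma C11_weaken (E : normedModType R) (f : V -> E) K K' :
  K <= K' -> C11_with f K -> C11_with f K'.
Proof.
move=> KK [bf lf ff]; split=> [x|x y|a b c e].
- exact: le_trans (bf x) KK.
- by apply: le_trans (lf x y) _; rewrite ler_wpM2r.
- by apply: le_trans (ff a b c e) _; rewrite ler_wpM2r// four_point_ge0.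
Qed.

Lemma C11_sup (E : normedModType R) (I : finType) (f : I -> V -> E) :
  (forall i, C11 (f i)) -> exists2 K : R, 0 <= K & forall i, C11_with (f i) K.
Proof.
move=> H; have /choice [K HK] : forall i, exists K, 0 <= K /\ C11_with (f i) K.
  by move=> i; have [K ? ?] := H i; exists K.
exists (\sum_i K i); first by apply: sumr_ge0 => i _; have [] := HK i.
move=> i; apply: C11_weaken (_ : K i <= _) _; last by have [] := HK i.
rewrite (bigD1 i)//= lerDl; apply: sumr_ge0 => j _; by have [] := HK j.
Qed.

Lemma C11_comb_with (E : normedModType R) (I : finType) (a : I -> R)
    (f : I -> V -> E) (A K : R) :
  0 <= K -> (forall i, `|a i| <= A) -> (forall i, C11_with (f i) K) ->
  C11_with (fun x => \sum_i a i *: f i x) (A * (\sum_(i : I) K)).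
Proof.
move=> K0 aA H; split=> [x|x y|b c d e].
- rewrite -[_ * _]mulr1 -mulrA; apply: norm_comb_le => // i.
  by rewrite mulr1; have [] := H i.
- rewrite -sumrB; under eq_bigr do rewrite -scalerBr.
  by rewrite -mulrA; apply: norm_comb_le => // i; have [] := H i.
- rewrite -!sumrB; under eq_bigr do rewrite -!scalerBr.
  rewrite -mulrA; apply: norm_comb_le => // [|i]; first exact: four_point_ge0.
  by have [] := H i.
Qed.

(** Stability of the four-point inequality under products comes from a discrete
    Leibniz rule of second order. *)
Lemma C11_mul (E : normedModType R) (a : V -> R^o) (f : V -> E) :
  C11 a -> C11 f -> C11 (fun x => a x *: f x).
Proof.
move=> [A A0 aA] [B B0 fB]; pose K := A + B.
have K0 : 0 <= K by rewrite addr_ge0.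
have {aA} [ba la fa] : C11_with a K by apply: C11_weaken aA; rewrite lerDl.
have {fB} [bf lf ff] : C11_with f K by apply: C11_weaken fB; rewrite lerDr.
exists (3 * K * K + K); first by rewrite addr_ge0// !mulr_ge0.
have KK : 0 <= K * K by rewrite mulr_ge0.
split=> [x|x y|x y z w].
- rewrite normrZ; apply: le_trans (ler_pM _ _ (ba x) (bf x)) _ => //; lra.
- have -> : a x *: f x - a y *: f y = (a x - a y) *: f x + a y *: (f x - f y).
    rewrite scalerBl scalerBr; abel.
  apply: le_trans (ler_normD _ _) _; rewrite !normrZ.
  have h1 := ler_pM (normr_ge0 _) (normr_ge0 _) (la x y) (bf x).
  have h2 := ler_pM (normr_ge0 _) (normr_ge0 _) (ba y) (lf x y).
  apply: le_trans (lerD h1 h2) _.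
  have -> : K * `|x - y| * K + K * (K * `|x - y|) = (2 * (K * K)) * `|x - y| by ring.
  by rewrite ler_wpM2r//; lra.
- have -> : a x *: f x - a y *: f y - (a z *: f z - a w *: f w) =
    (a x - a y - (a z - a w)) *: f x + (a z - a w) *: (f x - f z)
    + ((a y - a w) *: (f x - f y) + a w *: (f x - f y - (f z - f w))).
    rewrite !(scalerBl, scalerBr); abel.
  apply: le_trans (ler_normD _ _) _.
  apply: le_trans (lerD (ler_normD _ _) (ler_normD _ _)) _.
  rewrite !normrZ.
  have h1 := ler_pM (normr_ge0 _) (normr_ge0 _) (fa x y z w) (bf x).
  have h2 := ler_pM (normr_ge0 _) (normr_ge0 _) (la z w) (lf x z).
  have h3 := ler_pM (normr_ge0 _) (normr_ge0 _) (la y w) (lf x y).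
  have h4 := ler_pM (normr_ge0 _) (normr_ge0 _) (ba w) (ff x y z w).
  apply: le_trans (lerD (lerD h1 h2) (lerD h3 h4)) _.
  set Q := four_point x y z w.
  have Q0 : 0 <= Q := four_point_ge0 _ _ _ _.
  have hQ : `|z - w| * `|x - z| + `|y - w| * `|x - y| <= Q.
    rewrite /Q /four_point.
    have := normr_ge0 (x - y - (z - w)).
    have := mulr_ge0 (normr_ge0 (x - y)) (normr_ge0 (x - z)).
    have := mulr_ge0 (normr_ge0 (z - w)) (normr_ge0 (y - w)).
    by lra.
  have := ler_wpM2l KK hQ; have := mulr_ge0 K0 Q0; have := mulr_ge0 KK Q0.
  by lra.
Qed.

End C11.

Section Segments.
Variables (R : realType) (d p q : nat).
Local Notation V := ('cV[R]_d).
Local Notation E := ('M[R]_(p, q)).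
Implicit Type f : V -> E.

Lemma is_derive_segment f (x v : V) i j (t : R) :
  (forall y, differentiable f y) ->
  is_derive t 1 (fun r : R => f (x + r *: v) i j) ('d f (x + t *: v) v i j).
Proof.
move=> df; have dv : derivable f (x + t *: v) v by apply: diff_derivable.
have E1 := deriveE v (df (x + t *: v)).
have := (derivable_mxP _ _ _).1 dv i j => dij.
have E2 : 'D_v (fun y => f y i j) (x + t *: v) = 'd f (x + t *: v) v i j.
  by rewrite -E1 derive_mx// mxE.
rewrite -E2.
have shift (h : R) : h *: v + (x + t *: v) = x + (h + t) *: v.
  by rewrite scalerDl addrCA addrC -addrA [t *: v + _]addrC.
have key : (fun h : R => h^-1 *: (f (h *: v + (x + t *: v)) i j - f (x + t *: v) i j))
    = (fun h : R => h^-1 *: (f (x + (h *: 1 + t) *: v) i j - f (x + t *: v) i j)).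
  by apply/funext => h; rewrite shift [h *: 1]mulr1.
split.
  by move: dij; rewrite /derivable /= key.
by rewrite /derive /= key.
Qed.

Lemma mvt_unit (g dg : R -> R) (C : R) : (forall t : R, is_derive t 1 g (dg t)) ->
  (forall t, 0 <= t -> t <= 1 -> `|dg t| <= C) -> `|g 1 - g 0| <= C.
Proof.
move=> gd gC.
have gc : {within `[0, 1], continuous g}%classic.
  apply: continuous_subspaceT => x.
  by apply: differentiable_continuous; apply/derivable1_diffP; case: (gd x).
have [c] := MVT_segment ler01 (fun x _ => gd x) gc.
rewrite in_itv /= => /andP[c0 c1] ->; rewrite subr0 mulr1; exact: gC.
Qed.

(** Bounds in each direction are uniform over directions because a basis is
    finite. *)
Lemma diff_bound f : (forall v, exists M : R, forall x, `|'d f x v| <= M) ->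
  exists2 M : R, 0 <= M & forall x v, `|'d f x v| <= M * `|v|.
Proof.
move=> H.
have /choice [m Hm] : forall k : 'I_d, exists M : R, forall x, `|'d f x (delta_mx k 0)| <= M.
  by move=> k; exact: H.
exists (\sum_k `|m k|); first by rewrite sumr_ge0.
move=> x v; rewrite linear_basis mulrC -[_ * _]mulr1 -mulrA.
apply: norm_comb_le => // k; first exact: mx_entry_le.
by rewrite mulr1; apply: le_trans (Hm k x) (ler_norm _).
Qed.

Lemma diff_lipschitz f (M : R) : 0 <= M -> (forall x, differentiable f x) ->
  (forall x v, `|'d f x v| <= M * `|v|) ->
  forall x y, `|f x - f y| <= M * `|x - y|.
Proof.
move=> M0 df Mf x y; apply: mx_norm_le => [|i j]; first by rewrite mulr_ge0.
have := @mvt_unit (fun t => f (y + t *: (x - y)) i j) (fun t => 'd f (y + t *: (x - y)) (x - y) i j) (M * `|x - y|).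
rewrite scale1r scale0r addr0 [y + (x - y)]addrC subrK !mxE; apply.
- by move=> t; exact: is_derive_segment.
- by move=> t _ _; apply: le_trans (mx_entry_le _ _ _) (Mf _ _).
Qed.

Lemma Cb_lipschitz k f : Cb k.+1 f ->
  exists2 M : R, 0 <= M & forall x y, `|f x - f y| <= M * `|x - y|.
Proof.
move=> [_ [df bf]].
have [|M M0 HM] := @diff_bound f; first by move=> v; case: k bf => [|k] bf; have [] := bf v.
by exists M => //; exact: diff_lipschitz.
Qed.

Lemma diff_basis_lipschitz f : (forall v, exists2 M : R, 0 <= M &
    forall x y, `|'d f x v - 'd f y v| <= M * `|x - y|) ->
  exists2 M : R, 0 <= M &
    forall x y v, `|'d f x v - 'd f y v| <= M * `|x - y| * `|v|.
Proof.
move=> H.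
have /choice [m Hm] : forall k : 'I_d, exists M : R, forall x y,
   `|'d f x (delta_mx k 0) - 'd f y (delta_mx k 0)| <= M * `|x - y|.
  by move=> k; have [M _ ?] := H (delta_mx k 0); exists M.
exists (\sum_k `|m k|); first by rewrite sumr_ge0.
move=> x y v; rewrite mulrC.
apply: (@linear_sub_le _ _ _ ('d f x) ('d f y) _ _ v) => // k.
by apply: le_trans (Hm k x y) _; rewrite ler_wpM2r// ler_norm.
Qed.

Lemma segment_dist (a b c e : V) (t : R) : 0 <= t -> t <= 1 ->
  `|(b + t *: (a - b)) - (e + t *: (c - e))| <= `|a - c| + `|b - e|.
Proof.
move=> t0 t1.
have -> : (b + t *: (a - b)) - (e + t *: (c - e)) = t *: (a - c) + (1 - t) *: (b - e).
  rewrite !scalerBl !scale1r !scalerBr; abel.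
apply: le_trans (ler_normD _ _) _; rewrite !normrZ.
by rewrite lerD// ler_piMl// ger0_norm//; lra.
Qed.

Lemma linear_split (D D' : {linear V -> E}) (v w : V) i j :
  D v i j - D' w i j = (D (v - w) + (D w - D' w)) i j.
Proof. by rewrite linearB !mxE; ring. Qed.

(** The four-point inequality is the mean value theorem for the difference of
    [f] along the segments from [b] to [a] and from [e] to [c]. *)
Lemma Cb_C11 k f : Cb k.+2 f -> C11 f.
Proof.
move=> Cf; have [[M1 b1] [df dC]] := Cf.
have [M2 M20 l2] := Cb_lipschitz Cf.
have [M3 M30 l3] := diff_basis_lipschitz (fun v => Cb_lipschitz (dC v)).
have [|M4 M40 b4] := @diff_bound f; first by move=> v; have [] := dC v.
have M10 : 0 <= `|M1| by [].
exists (`|M1| + M2 + M3 + M4); first by rewrite !addr_ge0.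
split=> [x|x y|a b c e].
- apply: le_trans (b1 x) _; have := ler_norm M1; lra.
- by apply: le_trans (l2 x y) _; rewrite ler_wpM2r//; lra.
apply: mx_norm_le => [|i j].
  by rewrite mulr_ge0// ?four_point_ge0// !addr_ge0.
pose g t := f (b + t *: (a - b)) i j - f (e + t *: (c - e)) i j.
pose dg t := 'd f (b + t *: (a - b)) (a - b) i j - 'd f (e + t *: (c - e)) (c - e) i j.
have -> : (f a - f b - (f c - f e)) i j = g 1 - g 0.
  rewrite /g !scale1r !scale0r !addr0 ![_ + (_ - _)]addrC !subrK !mxE; ring.
apply: (@mvt_unit g dg) => [t|t t0 t1].
  by apply: is_deriveB; exact: is_derive_segment.
set P := b + t *: (a - b); set Q := e + t *: (c - e).
have -> : dg t = ('d f P (a - b - (c - e)) + ('d f P (c - e) - 'd f Q (c - e))) i j.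
  exact: linear_split ('d f P) ('d f Q) _ _ i j.
apply: le_trans (mx_entry_le _ _ _) _; apply: le_trans (ler_normD _ _) _.
apply: le_trans (lerD (b4 _ _) (l3 _ _ _)) _.
have PQ : `|P - Q| <= `|a - c| + `|b - e| by exact: segment_dist.
have h : M3 * `|P - Q| * `|c - e| <= M3 * ((`|a - b| + `|c - e|) * (`|a - c| + `|b - e|)).
  rewrite -mulrA ler_wpM2l// mulrC ler_pM//.
  by rewrite lerDr.
apply: le_trans (lerD (lexx _) h) _; rewrite /four_point.
set A := `|a - b - (c - e)|.
set B := (`|a - b| + `|c - e|) * (`|a - c| + `|b - e|).
have A0 : 0 <= A by exact: normr_ge0.
have B0 : 0 <= B by rewrite mulr_ge0// addr_ge0.
have h1 := mulr_ge0 M10 A0; have h2 := mulr_ge0 M20 A0; have h3 := mulr_ge0 M30 A0.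
have h4 := mulr_ge0 M10 B0; have h5 := mulr_ge0 M20 B0; have h6 := mulr_ge0 M40 B0.
by lra.
Qed.

End Segments.

(** * The Davie step *)

Section DavieField.
Variables (R : realType) (n d : nat).
Local Notation V := ('cV[R]_d).
Local Notation E := ('M[R]_(d, n)).
Implicit Types (F : V -> E) (DF : V -> {linear V -> E}) (K : R).

(** All that is used of the vector field: [F] and the columns of its derivative
    are C11, and the Taylor remainder of order one is quadratic and, as a
    function of the base point and the displacement, Lipschitz with small
    constant.  The derivative is a parameter so that the estimates below never
    unfold it. *)
Definition davie_field F DF K := [/\ C11_with F K,
  forall k, C11_with (fun x => DF x (delta_mx k 0)) K,
  forall x v, `|F (x + v) - F x - DF x v| <= K * `|v| ^+ 2 &
  forall x y v w, `|(F (x + v) - F x - DF x v) - (F (y + w) - F y - DF y w)|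
    <= K * (`|v| * `|v - w| + (`|v - w| + (`|v| + `|w|) * (2 * `|x - y| + `|v - w|)) * `|w|)].

Lemma linear_four_le (D1 D2 D3 D4 : {linear V -> E}) (m : 'I_d -> R) (B : R) v :
  0 <= B -> (forall k, `|D1 (delta_mx k 0) - D2 (delta_mx k 0)
     - (D3 (delta_mx k 0) - D4 (delta_mx k 0))| <= m k * B) ->
  `|D1 v - D2 v - (D3 v - D4 v)| <= `|v| * ((\sum_k m k) * B).
Proof.
move=> B0 H.
rewrite (linear_basis D1) (linear_basis D2) (linear_basis D3) (linear_basis D4).
rewrite -!sumrB; under eq_bigr do rewrite -!scalerBr.
by apply: norm_comb_le => // k; exact: mx_entry_le.
Qed.

Lemma linear_le (D : {linear V -> E}) (m : 'I_d -> R) v :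
  (forall k, `|D (delta_mx k 0)| <= m k) -> `|D v| <= (\sum_k m k) * `|v|.
Proof.
move=> H; rewrite (linear_basis D) mulrC -[_ * _]mulr1 -mulrA.
by apply: norm_comb_le => // k; rewrite ?mulr1 ?mx_entry_le.
Qed.

Lemma is_derive_mulr (c t : R) : is_derive t 1 (fun r : R => r * c) c.
Proof.
have -> : (fun r : R => r * c) = c *: (id : R -> R).
  by apply/funext => r; rewrite mulrC.
have := @is_deriveZ _ _ _ (id : R -> R) c t 1 1 (is_derive_id _ _).
by rewrite [c *: 1]mulr1.
Qed.

Lemma taylor_split (D1 D2 D3 D4 : {linear V -> E}) v w i j :
  (D1 v i j - D2 v i j) - (D3 w i j - D4 w i j) =
  ((D1 (v - w) - D2 (v - w)) + (D1 w - D2 w - (D3 w - D4 w))) i j.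
Proof. by rewrite (linearB D1) (linearB D2) !mxE; ring. Qed.

Lemma linear_sub_entry (D1 D2 : {linear V -> E}) v i j :
  D1 v i j - D2 v i j = (D1 v - D2 v) i j.
Proof. by rewrite !mxE. Qed.

Lemma remainder_entry (X Y D : E) i j :
  (X - Y - D) i j = X i j - D i j - (Y i j - 0).
Proof. by rewrite !mxE; ring. Qed.

Lemma remainder_sub_entry (X Y D X' Y' D' : E) i j :
  (X - Y - D - (X' - Y' - D')) i j =
  (X i j - D i j - (X' i j - D' i j)) - ((Y i j - 0) - (Y' i j - 0)).
Proof. by rewrite !mxE; ring. Qed.

(** The last two clauses follow from the mean value theorem along the segment
    from [x] to [x + v], applied to the remainder and to the difference of two
    remainders. *)
Lemma Cb_davie_field F : Cb 3 F -> exists2 K : R, 0 <= K &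
  davie_field F (fun x => 'd F x) K.
Proof.
move=> CF; have [K1 K10 cF] := Cb_C11 CF.
have [_ [dF CdF]] := CF.
have [K2 K20 cDF] := C11_sup (fun k : 'I_d => @Cb_C11 _ _ _ _ 0 _ (CdF (delta_mx k 0))).
pose S := \sum_(k < d) K2; have S0 : 0 <= S by rewrite sumr_ge0.
pose K := K1 + K2 + S; have K0 : 0 <= K by rewrite !addr_ge0.
have lipD x y v : `|'d F x v - 'd F y v| <= S * `|x - y| * `|v|.
  rewrite mulrC; apply: (@linear_sub_le _ _ _ ('d F x) ('d F y) _ _ v) => // k.
  by have [_ l _] := cDF k; exact: l.
have fourD a b c e v : `|'d F a v - 'd F b v - ('d F c v - 'd F e v)|
    <= S * four_point a b c e * `|v|.
  rewrite mulrC; apply: (@linear_four_le ('d F a) ('d F b) ('d F c) ('d F e)).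
    exact: four_point_ge0.
  by move=> k; have [_ _ f] := cDF k; exact: f.
exists K => //; split.
- by apply: C11_weaken cF; rewrite /K; lra.
- by move=> k; apply: C11_weaken (cDF k); rewrite /K; lra.
- move=> x v; apply: mx_norm_le => [|i j]; first by rewrite mulr_ge0// exprn_ge0.
  pose g (t : R) := F (x + t *: v) i j - t * ('d F x v i j).
  pose dg (t : R) := 'd F (x + t *: v) v i j - 'd F x v i j.
  have -> : (F (x + v) - F x - 'd F x v) i j = g 1 - g 0.
    rewrite /g scale1r scale0r addr0 mul1r mul0r.
    exact: remainder_entry.
  apply: (@mvt_unit _ g dg) => [t|t t0 t1].
    by apply: is_deriveB; [exact: is_derive_segment | exact: is_derive_mulr].
  have -> : dg t = ('d F (x + t *: v) v - 'd F x v) i j.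
    exact: linear_sub_entry ('d F (x + t *: v)) ('d F x) v i j.
  apply: le_trans (mx_entry_le _ _ _) _; apply: le_trans (lipD _ _ _) _.
  rewrite addrAC subrr add0r normrZ ger0_norm// expr2 -!mulrA.
  have vv : 0 <= `|v| * `|v| by rewrite mulr_ge0.
  apply: ler_pM => //; first by rewrite mulr_ge0.
    by rewrite /K; lra.
  by rewrite ler_piMl.
- move=> x y v w.
  set Q := `|v| * `|v - w| + _.
  have Q0 : 0 <= Q by rewrite addr_ge0 ?mulr_ge0 ?addr_ge0 ?mulr_ge0 ?addr_ge0 ?mulr_ge0.
  apply: mx_norm_le => [|i j]; first by rewrite mulr_ge0.
  pose g (t : R) := (F (x + t *: v) i j - t * ('d F x v i j)) - (F (y + t *: w) i j - t * ('d F y w i j)).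
  pose dg (t : R) := ('d F (x + t *: v) v i j - 'd F x v i j) - ('d F (y + t *: w) w i j - 'd F y w i j).
  have -> : ((F (x + v) - F x - 'd F x v) - (F (y + w) - F y - 'd F y w)) i j = g 1 - g 0.
    rewrite /g !scale1r !scale0r !addr0 !mul1r !mul0r.
    exact: remainder_sub_entry.
  apply: (@mvt_unit _ g dg) => [t|t t0 t1].
    by apply: is_deriveB; apply: is_deriveB; (exact: is_derive_segment || exact: is_derive_mulr).
  have -> : dg t = (('d F (x + t *: v) (v - w) - 'd F x (v - w)) +
     ('d F (x + t *: v) w - 'd F x w - ('d F (y + t *: w) w - 'd F y w))) i j.
    exact: taylor_split ('d F (x + t *: v)) ('d F x) ('d F (y + t *: w)) ('d F y) v w i j.
  apply: le_trans (mx_entry_le _ _ _) _; apply: le_trans (ler_normD _ _) _.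
  apply: le_trans (lerD (lipD _ _ _) (fourD _ _ _ _ _)) _.
  have tE (a b : V) : a + t *: b - a = t *: b by rewrite addrAC subrr add0r.
  have tle (b : V) : `|t *: b| <= `|b| by rewrite normrZ ger0_norm// ler_piMl.
  rewrite /four_point !tE -scalerBr.
  have h1 : `|x + t *: v - (y + t *: w)| <= `|x - y| + `|v - w|.
    have -> : x + t *: v - (y + t *: w) = (x - y) + t *: (v - w) by rewrite scalerBr; abel.
    by apply: le_trans (ler_normD _ _) _; rewrite lerD2l.
  apply: le_trans (_ : S * Q <= _); last by rewrite ler_wpM2r// /K; lra.
  rewrite -!mulrA -mulrDr ler_wpM2l// /Q; apply: lerD; first by rewrite ler_wpM2r.
  rewrite ler_wpM2r//; apply: lerD; first exact: tle.
  apply: ler_pM; rewrite ?addr_ge0//; first by apply: lerD; exact: tle.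
  by apply: le_trans (lerD h1 (lexx _)) _; lra.
Qed.

(** The second order coefficient of the Davie step, F'(x)(F(x) .) contracted
    with the tensor [A]. *)
Definition second F DF (x : V) (A : 'M[R]_n) : V :=
  \sum_(ij : 'I_n * 'I_n) A ij.1 ij.2 *:
    (DF x (F x *m delta_mx ij.1 (0 : 'I_1)) *m delta_mx ij.2 (0 : 'I_1)).

Lemma secondD F DF x A B :
  second F DF x (A + B) = second F DF x A + second F DF x B.
Proof.
by rewrite /second -big_split; apply: eq_bigr => ij _; rewrite mxE scalerDl.
Qed.

(** On pure tensors the contraction is the derivative of [F] in the direction
    [F x *m u]: this is what cancels the Chen term of the rough path. *)
Lemma second_tensor F DF x (u w : 'cV[R]_n) :
  second F DF x (u *m w^T) = DF x (F x *m u) *m w.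
Proof.
have -> : DF x (F x *m u) = \sum_i u i 0 *: DF x (F x *m delta_mx i 0).
  rewrite {1}(cV_basis u) mulmx_sumr linear_sum; apply: eq_bigr => i _.
  by rewrite -scalemxAr linearZ.
have colE (B : E) : B *m w = \sum_j w j 0 *: (B *m delta_mx j 0).
  by rewrite {1}(cV_basis w) mulmx_sumr; apply: eq_bigr => j _; rewrite scalemxAr.
rewrite mulmx_suml; under eq_bigr do rewrite -scalemxAl colE scaler_sumr.
rewrite pair_big /=; apply: eq_bigr => -[i j] _ /=.
by rewrite !mxE big_ord1 !mxE scalerA.
Qed.

End DavieField.

Section DavieStep.
Variables (R : realType) (n d : nat).
Local Notation V := ('cV[R]_d).
Local Notation E := ('M[R]_(d, n)).

Lemma C11_additive (U : normedModType R) (E1 E2 : normedModType R)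
    (L : E1 -> E2) (c : R) (f : U -> E1) : 0 <= c ->
  (forall x y, L (x - y) = L x - L y) -> (forall x, `|L x| <= c * `|x|) ->
  C11 f -> C11 (fun x => L (f x)).
Proof.
move=> c0 LB Lc [K K0 [bf lf ff]]; exists (c * K); first by rewrite mulr_ge0.
split=> [x|x y|a b z e].
- by apply: le_trans (Lc _) _; rewrite ler_wpM2l.
- by rewrite -LB -mulrA; apply: le_trans (Lc _) _; rewrite ler_wpM2l.
- by rewrite -!LB -mulrA; apply: le_trans (Lc _) _; rewrite ler_wpM2l.
Qed.

Lemma C11_sum (U E1 : normedModType R) (I : finType) (f : I -> U -> E1) :
  (forall i, C11 (f i)) -> C11 (fun x => \sum_i f i x).
Proof.
move=> H; have [K K0 HK] := C11_sup H.
have [|b l q] := @C11_comb_with _ _ _ _ (fun=> 1) f 1 K K0 _ HK.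
  by move=> _; rewrite normr1.
exists (1 * \sum_(i : I) K); first by rewrite mul1r sumr_ge0.
have E x : \sum_i 1 *: f i x = \sum_i f i x by apply: eq_bigr => i _; rewrite scale1r.
by split=> [x|x y|x y z w]; rewrite -!E.
Qed.

Lemma C11_entry (U : normedModType R) m p (f : U -> 'M[R]_(m, p)) i j :
  C11 f -> C11 (fun x => f x i j : R^o).
Proof.
apply: (@C11_additive U _ R^o (fun A : 'M[R]_(m, p) => A i j) 1) => // [x y|x].
  by rewrite !mxE.
by rewrite mul1r mx_entry_le.
Qed.

Lemma C11_mulmxr (U : normedModType R) m p q (B : 'M[R]_(p, q))
    (f : U -> 'M[R]_(m, p)) : C11 f -> C11 (fun x => f x *m B).
Proof.
apply: (@C11_additive U _ _ (fun A : 'M[R]_(m, p) => A *m B) (p%:R * `|B|)) => [|x y|x].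
- by rewrite mulr_ge0.
- by rewrite mulmxBl.
- by apply: le_trans (mulmx_norm _ _) _; rewrite -mulrA [`|B| * _]mulrC.
Qed.

Lemma C11_apply (DF : V -> {linear V -> E}) (g : V -> V) :
  (forall k, C11 (fun x => DF x (delta_mx k 0))) -> C11 g ->
  C11 (fun x => DF x (g x)).
Proof.
move=> HD Hg.
have -> : (fun x => DF x (g x)) = (fun x => \sum_k g x k 0 *: DF x (delta_mx k 0)).
  by apply/funext => x; exact: linear_basis.
by apply: C11_sum => k; apply: C11_mul => //; exact: C11_entry.
Qed.

Variables (F : V -> E) (DF : V -> {linear V -> E}) (K : R).
Hypotheses (K0 : 0 <= K) (FK : davie_field F DF K).

Lemma second_C11 : exists2 K' : R, 0 <= K' &
  forall A, C11_with (fun x => second F DF x A) (`|A| * K').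
Proof.
have [cF cD _ _] := FK.
have C ij : C11 (fun x => DF x (F x *m delta_mx ij.1 (0 : 'I_1)) *m delta_mx ij.2 (0 : 'I_1)).
  apply: C11_mulmxr; apply: C11_apply; first by move=> k; exists K.
  by apply: C11_mulmxr; exists K.
have [K' K'0 H] := C11_sup C.
exists (\sum_(ij : 'I_n * 'I_n) K'); first by rewrite sumr_ge0.
move=> A; apply: C11_comb_with => // ij; exact: mx_entry_le.
Qed.

Lemma diff_second_C11 : exists2 K' : R, 0 <= K' &
  forall A, C11_with (fun x => DF x (second F DF x A)) (`|A| * K').
Proof.
have [cF cD _ _] := FK.
have C ij : C11 (fun x => DF x (DF x (F x *m delta_mx ij.1 (0 : 'I_1)) *m delta_mx ij.2 (0 : 'I_1))).
  apply: C11_apply; first by move=> k; exists K.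
  apply: C11_mulmxr; apply: C11_apply; first by move=> k; exists K.
  by apply: C11_mulmxr; exists K.
have [K' K'0 H] := C11_sup C.
exists (\sum_(ij : 'I_n * 'I_n) K'); first by rewrite sumr_ge0.
move=> A.
have -> : (fun x => DF x (second F DF x A)) = (fun x => \sum_ij A ij.1 ij.2 *:
    DF x (DF x (F x *m delta_mx ij.1 (0 : 'I_1)) *m delta_mx ij.2 (0 : 'I_1))).
  apply/funext => x; rewrite linear_sum; apply: eq_bigr => ij _.
  by rewrite linearZ.
apply: C11_comb_with => // ij; exact: mx_entry_le.
Qed.

Definition drift (w : 'cV[R]_n) (A : 'M[R]_n) (x : V) : V :=
  F x *m w + second F DF x A.

Definition davie_step (W : R -> 'cV[R]_n) (WW : R -> R -> 'M[R]_n) (s t : R)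
  (x : V) : V := x + drift (incr W s t) (WW s t) x.

(** Chen's relation and the Taylor expansion of [F] at [x] leave three terms, of
    orders [v^2 w2], [A1 w2] and [v A2]: each has total order three when [w1],
    [w2] count once and [A1], [A2] twice. *)
Lemma drift_defect (w1 w2 : 'cV[R]_n) (A1 A2 : 'M[R]_n) x :
  let v := drift w1 A1 x in
  (x + v) + drift w2 A2 (x + v) - (x + drift (w1 + w2) (A1 + A2 + w1 *m w2^T) x) =
  (F (x + v) - F x - DF x v) *m w2 + DF x (second F DF x A1) *m w2
  + (second F DF (x + v) A2 - second F DF x A2).
Proof.
move=> v.
have vE : v = F x *m w1 + second F DF x A1 by [].
have DFv : DF x v *m w2 = second F DF x (w1 *m w2^T)
    + DF x (second F DF x A1) *m w2.
  by rewrite second_tensor vE (linearD (DF x)) mulmxDl.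
rewrite !mulmxBl DFv /drift !secondD mulmxDr vE; abel.
Qed.

Lemma davie_step_defect W WW s u t x :
  WW s t - WW s u - WW u t = incr W s u *m (incr W u t)^T ->
  let v := drift (incr W s u) (WW s u) x in
  davie_step W WW u t (davie_step W WW s u x) - davie_step W WW s t x =
  (F (x + v) - F x - DF x v) *m incr W u t
  + DF x (second F DF x (WW s u)) *m incr W u t
  + (second F DF (x + v) (WW u t) - second F DF x (WW u t)).
Proof.
move=> chen v.
have WWst : WW s t = WW s u + WW u t + incr W s u *m (incr W u t)^T.
  by rewrite -chen; abel.
have Wst : incr W s t = incr W s u + incr W u t by rewrite /incr; abel.
by rewrite -drift_defect /davie_step WWst Wst.
Qed.

Lemma drift_C11 : exists2 c : R, 0 <= c &
  forall w A, C11_with (drift w A) (c * (`|w| + `|A|)).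
Proof.
have [K' K'0 HK'] := second_C11; have [[bF lF fF] _ _ _] := FK.
have c0 : 0 <= n%:R * K :> R by rewrite mulr_ge0.
exists (n%:R * K + K'); first by rewrite addr_ge0.
move=> w A; have [bG lG fG] := HK' A.
have key X (a b : R) : 0 <= X -> a <= n%:R * (K * X * `|w|) -> b <= `|A| * K' * X ->
    a + b <= (n%:R * K + K') * (`|w| + `|A|) * X.
  move=> X0 ha hb; apply: le_trans (lerD ha hb) _.
  have h1 : 0 <= n%:R * K * `|A| * X by rewrite !mulr_ge0.
  have h2 : 0 <= K' * `|w| * X by rewrite !mulr_ge0.
  by lra.
split=> [x|x y|x y z e].
- rewrite -[leRHS]mulr1; apply: le_trans (ler_normD _ _) _; apply: key => //.
    by rewrite mulr1; apply: mulmx_le.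
  by rewrite mulr1.
- have -> : drift w A x - drift w A y = (F x - F y) *m w
      + (second F DF x A - second F DF y A) by rewrite /drift mulmxBl; abel.
  apply: le_trans (ler_normD _ _) _; apply: key => //.
  by apply: mulmx_le.
- have -> : drift w A x - drift w A y - (drift w A z - drift w A e)
      = (F x - F y - (F z - F e)) *m w + (second F DF x A - second F DF y A
         - (second F DF z A - second F DF e A)) by rewrite /drift !mulmxBl; abel.
  apply: le_trans (ler_normD _ _) _; apply: key; first exact: four_point_ge0.
    by apply: mulmx_le.
  exact: fG.
Qed.

End DavieStep.

Section DavieFlow.
Variables (R : realType) (n d : nat).
Local Notation V := ('cV[R]_d).
Local Notation E := ('M[R]_(d, n)).
Variables (F : V -> E) (DF : V -> {linear V -> E}) (K : R).
Hypotheses (K0 : 0 <= K) (FK : davie_field F DF K).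
Variables (T beta C : R) (W : R -> 'cV[R]_n) (WW : R -> R -> 'M[R]_n).
Hypotheses (beta0 : 0 < beta) (C0 : 0 <= C).

Definition rough_bounds := [/\
  forall s u t, 0 <= s <= T -> 0 <= u <= T -> 0 <= t <= T ->
    WW s t - WW s u - WW u t = incr W s u *m (incr W u t)^T,
  forall s t, 0 <= s -> s <= t -> t <= T -> `|incr W s t| <= C * (t - s) `^ beta &
  forall s t, 0 <= s -> s <= t -> t <= T -> `|WW s t| <= C * ((t - s) `^ beta) ^+ 2].

Hypothesis rough : rough_bounds.

Lemma powR3 (x : R) : x `^ (3 * beta) = (x `^ beta) ^+ 3.
Proof. by rewrite mulrC powRrM powR_mulrn// powR_ge0. Qed.

Lemma rough_sub (s a b t : R) : 0 <= s -> s <= a -> a <= b -> b <= t -> t <= T ->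
  `|incr W a b| <= C * (t - s) `^ beta /\
  `|WW a b| <= C * ((t - s) `^ beta) ^+ 2.
Proof.
move=> s0 sa ab bt tT; have [_ HW HWW] := rough.
have w : (b - a) `^ beta <= (t - s) `^ beta.
  by apply: powR_mono; [exact: ltW | rewrite subr_ge0 | lra].
split.
  by apply: le_trans (HW _ _ _ ab _) _; [lra|lra|rewrite ler_wpM2l].
apply: le_trans (HWW _ _ _ ab _) _; [lra|lra|rewrite ler_wpM2l//].
by rewrite lerXn2r// nnegrE powR_ge0.
Qed.

Lemma WWxx s : 0 <= s <= T -> WW s s = 0.
Proof.
move=> sT; have [chen _ _] := rough; have := chen s s s sT sT sT.
by rewrite subrr sub0r /incr subrr mul0mx => /eqP; rewrite oppr_eq0 => /eqP.
Qed.

(** Each of the three terms of [drift_defect] carries three factors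
    [o] = |t - s|^beta: a remainder, quadratic in the drift, times an increment
    of [W], or a value of [WW] times an increment of [W] or the drift.  The
    Lipschitz clause has the same factors times |x - y|. *)
Lemma davie_step_flow : 0 <= T -> exists2 M : R, 0 <= M &
  lipschitz_almost_flow T (3 * beta) beta M (davie_step F DF W WW).
Proof.
move=> T0; have [chen _ _] := rough; have [_ _ rem rem_lip] := FK.
have [c c0 Hc] := drift_C11 K0 FK.
have [K1 K10 HG] := second_C11 K0 FK.
have [K2 K20 HH] := diff_second_C11 K0 FK.
pose Om := T `^ beta; have Om0 : 0 <= Om := powR_ge0 _ _.
have omO (s t : R) : 0 <= s -> s <= t -> t <= T -> (t - s) `^ beta <= Om.
  by move=> s0 st tT; apply: powR_mono; [exact: ltW | rewrite subr_ge0 | lra].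
pose cc := c * (C * (1 + Om)).
have cc0 : 0 <= cc by rewrite mulr_ge0// mulr_ge0// addr_ge0.
have dr (s a b t : R) : 0 <= s -> s <= a -> a <= b -> b <= t -> t <= T ->
    C11_with (drift F DF (incr W a b) (WW a b)) (cc * (t - s) `^ beta).
  move=> s0 sa ab bt tT; apply: C11_weaken (Hc _ _).
  have [h1 h2] := @rough_sub s a b t s0 sa ab bt tT.
  rewrite /cc -!mulrA ler_wpM2l//; apply: le_trans (lerD h1 h2) _.
  rewrite -mulrDr ler_wpM2l// mulrDl mul1r lerD2l expr2 ler_wpM2r ?powR_ge0//.
  by apply: omO => //; lra.
pose M3 := n%:R * (K * cc ^+ 2 * C) + n%:R * (C * K2 * C) + C * K1 * cc.
pose M4 := n%:R * (K * cc ^+ 2 * (6 + 2 * cc * Om) * C) + n%:R * (C * K2 * C)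
  + C * K1 * (cc * (5 + 2 * cc * Om)).
have M30 : 0 <= M3 by rewrite /M3 !(addr_ge0, mulr_ge0, exprn_ge0).
have M40 : 0 <= M4.
  by rewrite /M4 !(addr_ge0, mulr_ge0, exprn_ge0).
exists (cc + M3 + M4); first exact: addr_ge0 (addr_ge0 cc0 M30) M40.
have nuE (s t : R) x : davie_step F DF W WW s t x - x = drift F DF (incr W s t) (WW s t) x.
  by rewrite /davie_step addrAC subrr add0r.
split.
- move=> s x s0 sT; rewrite /davie_step /drift WWxx ?s0// /incr subrr mulmx0.
  rewrite /second big1 ?addr0// => ij _; by rewrite mxE scale0r.
- move=> s t x y s0 st tT; rewrite !nuE.
  have [_ l _] := dr s s t t s0 (lexx _) st (lexx _) tT.
  apply: le_trans (l x y) _; rewrite ler_wpM2r// ler_wpM2r ?powR_ge0//; lra.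
- move=> s t x y x' y' s0 st tT; rewrite !nuE.
  have [_ _ f] := dr s s t t s0 (lexx _) st (lexx _) tT.
  apply: le_trans (f x y x' y') _.
  by rewrite ler_wpM2r ?four_point_ge0// ler_wpM2r ?powR_ge0//; lra.
- move=> s u t x s0 su ut tT.
  have ch := chen s u t; rewrite davie_step_defect; last by apply: ch; apply/andP; lra.
  have [v1 _ _] := dr s s u t s0 (lexx _) su ut tT.
  have [W2 WW2] := @rough_sub s u t t s0 su ut (lexx _) tT.
  have [_ WW1] := @rough_sub s s u t s0 (lexx _) su ut tT.
  have {}v1 := v1 x; set v := drift _ _ _ _ x in v1 *.
  have o0 := powR_ge0 (t - s) beta; rewrite powR3.
  set o := (t - s) `^ beta in v1 W2 WW1 WW2 o0 *.
  have [_ lG _] := HG (WW u t); have [bH _ _] := HH (WW s u).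
  have r1 : `|F (x + v) - F x - DF x v| <= K * (cc * o) ^+ 2.
    by apply: le_trans (rem x v) _; rewrite ler_wpM2l// lerXn2r// nnegrE// mulr_ge0.
  have r2 : `|DF x (second F DF x (WW s u))| <= C * o ^+ 2 * K2.
    by apply: le_trans (bH x) _; rewrite ler_wpM2r.
  have r3 : `|second F DF (x + v) (WW u t) - second F DF x (WW u t)| <= C * o ^+ 2 * K1 * (cc * o).
    apply: le_trans (lG _ _) _; rewrite [x + v - x]addrAC subrr add0r.
    by apply: ler_pM => //; [rewrite mulr_ge0 | rewrite ler_wpM2r].
  apply: le_trans (ler_normD _ _) _; apply: le_trans (lerD (ler_normD _ _) r3) _.
  apply: le_trans (lerD (lerD (mulmx_le r1 W2) (mulmx_le r2 W2)) (lexx _)) _.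
  apply: le_trans (_ : M3 * o ^+ 3 <= _); last first.
    by rewrite ler_wpM2r ?exprn_ge0//; lra.
  by rewrite le_eqVlt /M3; apply/orP; left; apply/eqP; ring.
- move=> s u t x y s0 su ut tT.
  have ch := chen s u t; have {}ch : WW s t - WW s u - WW u t = incr W s u *m (incr W u t)^T.
    by apply: ch; apply/andP; lra.
  rewrite (congr2 (fun a b : V => a - b) (davie_step_defect F DF x ch) (davie_step_defect F DF y ch)).
  have [v1 v2 _] := dr s s u t s0 (lexx _) su ut tT.
  have [W2 WW2] := @rough_sub s u t t s0 su ut (lexx _) tT.
  have [_ WW1] := @rough_sub s s u t s0 (lexx _) su ut tT.
  have vx := v1 x; have vy := v1 y; have vxy := v2 x y.
  set v := drift _ _ _ _ x in vx vxy *; set w := drift _ _ _ _ y in vy vxy *.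
  have o0 := powR_ge0 (t - s) beta; rewrite powR3.
  have oO := omO s t s0 (le_trans su ut) tT.
  set o := (t - s) `^ beta in vx vy vxy W2 WW1 WW2 o0 oO *.
  have [_ _ fG] := HG (WW u t); have [_ lH _] := HH (WW s u).
  set D := `|x - y| in vxy *; have D0 : 0 <= D := normr_ge0 _.
  have co0 : 0 <= cc * o by rewrite mulr_ge0.
  have vwO : `|v - w| <= cc * Om * D.
    by apply: le_trans vxy _; rewrite ler_wpM2r// ler_wpM2l.
  have vw2 : `|v| + `|w| <= 2 * (cc * o) by lra.
  have r1 : `|(F (x + v) - F x - DF x v) - (F (y + w) - F y - DF y w)|
      <= K * (cc ^+ 2 * (6 + 2 * cc * Om) * o ^+ 2 * D).
    apply: le_trans (rem_lip x y v w) _; rewrite ler_wpM2l//.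
    have h1 := ler_pM (normr_ge0 _) (normr_ge0 _) vx vxy.
    have h2 : (`|v| + `|w|) * (2 * D + `|v - w|) <= 2 * (cc * o) * (2 * D + cc * Om * D).
      by apply: ler_pM; rewrite ?addr_ge0 ?mulr_ge0//; lra.
    have h3 : (`|v - w| + (`|v| + `|w|) * (2 * D + `|v - w|)) * `|w|
       <= (cc * o * D + 2 * (cc * o) * (2 * D + cc * Om * D)) * (cc * o).
      apply: ler_pM => //; last by apply: lerD.
      by rewrite !addr_ge0// mulr_ge0// addr_ge0// mulr_ge0.
    apply: le_trans (lerD h1 h3) _.
    by rewrite le_eqVlt; apply/orP; left; apply/eqP; ring.
  have r2 : `|DF x (second F DF x (WW s u)) - DF y (second F DF y (WW s u))| <= C * o ^+ 2 * K2 * D.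
    by apply: le_trans (lH x y) _; rewrite ler_wpM2r// ler_wpM2r.
  have r3 : `|second F DF (x + v) (WW u t) - second F DF x (WW u t)
     - (second F DF (y + w) (WW u t) - second F DF y (WW u t))|
     <= C * o ^+ 2 * K1 * (cc * (5 + 2 * cc * Om) * o * D).
    apply: le_trans (fG _ _ _ _) _.
    apply: ler_pM; rewrite ?mulr_ge0 ?four_point_ge0//; first by rewrite ler_wpM2r.
    have tE (a b : V) : a + b - a = b by rewrite addrAC subrr add0r.
    rewrite /four_point !tE.
    have h1 : `|x + v - (y + w)| <= D + cc * Om * D.
      have -> : x + v - (y + w) = (x - y) + (v - w) by abel.
      by apply: le_trans (ler_normD _ _) _; rewrite lerD2l.
    have h2 : (`|v| + `|w|) * (`|x + v - (y + w)| + D) <= 2 * (cc * o) * (D + cc * Om * D + D).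
      by apply: ler_pM; rewrite ?addr_ge0//; lra.
    apply: le_trans (lerD vxy h2) _.
    by rewrite le_eqVlt; apply/orP; left; apply/eqP; ring.
  have split3 (a1 a2 b1 b2 : E) (z : 'cV[R]_n) (e1 e2 : V) :
     a1 *m z + b1 *m z + e1 - (a2 *m z + b2 *m z + e2) =
     (a1 - a2) *m z + (b1 - b2) *m z + (e1 - e2).
    by rewrite !mulmxBl; abel.
  rewrite split3.
  apply: le_trans (ler_normD _ _) _; apply: le_trans (lerD (ler_normD _ _) r3) _.
  apply: le_trans (lerD (lerD (mulmx_le r1 W2) (mulmx_le r2 W2)) (lexx _)) _.
  apply: le_trans (_ : M4 * o ^+ 3 * D <= _); last first.
    by rewrite ler_wpM2r// ler_wpM2r ?exprn_ge0//; lra.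
  by rewrite le_eqVlt /M4; apply/orP; left; apply/eqP; ring.
Qed.

End DavieFlow.

(** * Sewing and the rough integral *)

Section Partitions.
Variables (R : realType) (V : normedModType R).
Implicit Types (Xi : R -> R -> V) (s : seq R) (a b : R).

Definition fine_path (delta a : R) s := path (fun x y => y - x < delta) a s.

Lemma fine_pathP delta a s : reflect
  (forall k, (k < size s)%N -> nth 0 (a :: s) k.+1 - nth 0 (a :: s) k < delta)
  (fine_path delta a s).
Proof. exact: pathP. Qed.

Lemma fine_partition_exists a b delta : 0 < delta -> a <= b ->
  exists s, itv_partition a b s /\ fine_path delta a s.
Proof.
move=> d0; pose m := Num.bound ((b - a) / (delta / 2)).
move=> ab; have : b - a <= m%:R * (delta / 2).
  rewrite -ler_pdivrMr ?divr_gt0//; apply: ltW; apply: archi_boundP.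
  by rewrite divr_ge0 ?subr_ge0 ?divr_ge0// ltW.
move: m => m; elim: m a ab => [|m IH] a ab.
  rewrite mul0r subr_le0 => ba; exists [::].
  by split => //; split => //=; rewrite eq_le ab ba.
have [->|nab] := eqVneq a b; first by exists [::]; split => //; split => /=.
have lab : a < b by rewrite lt_neqAle nab.
have [bd|bd] := ltP (b - a) delta.
  move=> _; exists [:: b]; split; last by rewrite /fine_path /= bd.
  exact: itv_partition1.
rewrite -natr1 mulrDl mul1r => hb.
have [||s [[ps ls] fs]] := IH (a + delta / 2); [lra|lra|].
exists (a + delta / 2 :: s); split; first by split => //=; rewrite ps andbT; lra.
by rewrite /fine_path /= [path _ _ _]fs andbT; lra.
Qed.

Definition psum Xi a s : V :=
  \sum_(0 <= k < size s) Xi (nth 0 (a :: s) k) (nth 0 (a :: s) k.+1).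

Lemma psum_nil Xi a : psum Xi a [::] = 0.
Proof. by rewrite /psum big_geq. Qed.

Lemma psum_cons Xi a x s : psum Xi a (x :: s) = Xi a x + psum Xi x s.
Proof. by rewrite /psum /= big_nat_recl. Qed.

Lemma psum_cat Xi a s1 s2 :
  psum Xi a (s1 ++ s2) = psum Xi a s1 + psum Xi (last a s1) s2.
Proof.
elim: s1 a => [|x s1 IH] a /=; first by rewrite psum_nil add0r.
by rewrite !psum_cons IH addrA.
Qed.

Lemma partition_grid (T : R) a b s : 0 <= a -> b <= T -> itv_partition a b s ->
  grid T (nth b (a :: s)).
Proof.
move=> a0 bT abs; have [ps /eqP ls] := abs.
have ab := itv_partition_le abs.
have leb k : nth b (a :: s) k <= b.
  have [ks|ks] := ltnP k (size s).+1; last by rewrite nth_default.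
  exact: itv_partition_nth_le ks abs.
have gea k : a <= nth b (a :: s) k.
  have [ks|ks] := ltnP k (size s).+1; last by rewrite nth_default.
  exact: itv_partition_nth_ge ks abs.
split=> [|k]; last by rewrite (le_trans a0 (gea k)) (le_trans (leb k)).
apply: homo_leq => [x|y x z|k]; [exact: lexx | exact: le_trans | ].
have [ks|ks] := ltnP k (size s).
  by move/(pathP b) : ps => /(_ k ks) /ltW.
by rewrite [leRHS]nth_default.
Qed.

(** The linear sewing lemma is the sup norm estimate for Euler schemes of the
    translations [x |-> x + Xi s t], for which two steps differ from one by the
    failure of additivity of [Xi].  It holds on the whole of [0, T] because
    translations are at distance 0 from the identity in Lipschitz norm. *)
Lemma linear_sewing (T th M : R) Xi : 1 < th -> 0 <= M ->
  (forall u : R, 0 <= u -> u <= T -> Xi u u = 0) ->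
  (forall u v w : R, 0 <= u -> u <= v -> v <= w -> w <= T ->
    `|Xi u w - Xi u v - Xi v w| <= M * (w - u) `^ th) ->
  forall a b s, 0 <= a -> b <= T -> itv_partition a b s ->
    `|psum Xi a s - Xi a b| <= sew_cst th M * (b - a) `^ th.
Proof.
move=> th1 M0 Xi0 dXi a b s a0 bT abs.
have gp := partition_grid a0 bT abs; have [ps /eqP ls] := abs.
pose mu (u v : R) (x : V) := x + Xi u v.
pose x k := \sum_(0 <= i < k) Xi (nth b (a :: s) i) (nth b (a :: s) i.+1).
have ex : exact_scheme mu (nth b (a :: s)) x.
  by move=> k; rewrite /x big_nat_recr.
have mu_id u x' : 0 <= u -> u <= T -> mu u u x' = x'.
  by move=> u0 uT; rewrite /mu Xi0// addr0.
have mu_lip (u v : R) (x1 x2 : V) : 0 <= u -> u <= v -> v <= T -> v - u <= T ->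
    `|(mu u v x1 - x1) - (mu u v x2 - x2)| <= sew_eps th * `|x1 - x2|.
  have tE (p q : V) : p + q - p = q by rewrite addrAC subrr add0r.
  move=> *; rewrite /mu !tE subrr normr0.
  by rewrite mulr_ge0// ltW// sew_eps_gt0.
have mu_def (u v w : R) (x' : V) : 0 <= u -> u <= v -> v <= w -> w <= T ->
    `|mu v w (mu u v x') - mu u w x'| <= M * (w - u) `^ th.
  move=> u0 uv vw wT; have -> : mu v w (mu u v x') - mu u w x'
    = - (Xi u w - Xi u v - Xi v w) by rewrite /mu; abel.
  by rewrite normrN; exact: dXi.
have := scheme_defect th1 M0 mu_id mu_lip mu_def gp ex (n := size s).
have p0 : nth b (a :: s) 0 = a by [].
have pn : nth b (a :: s) (size s) = b := itv_partition_nth_size b abs.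
rewrite pn p0; have ba : b - a <= T by lra.
move=> /(_ ba); rewrite {2}/x big_geq// /mu add0r.
congr (`|_ - _| <= _); rewrite /x /psum; apply: eq_big_nat => i /andP[_ si].
by congr (Xi _ _); apply: set_nth_default => //=; rewrite ltnW.
Qed.

End Partitions.

Section RoughIntegral.
Variables (R : realType) (n d : nat).
Variables (W : R -> 'cV[R]_n) (WW : R -> R -> 'M[R]_n).
Variables (z : R -> 'M[R]_(d, n)) (z' : R -> {linear 'cV[R]_n -> 'M[R]_(d, n)}).
Local Notation Xi := (germ W WW z z').

Lemma has_rough_integralP t I : has_rough_integral W WW z z' t I <->
  forall e : R, 0 < e -> exists2 delta : R, 0 < delta & forall s,
    itv_partition 0 t s -> fine_path delta 0 s -> `|psum Xi 0 s - I| < e.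
Proof.
split=> H e /H[delta d0 Hd]; exists delta => // s ps.
  by move/fine_pathP => fs; exact: Hd.
by move=> p /fine_pathP fs; exact: Hd.
Qed.

(** The integral over [0, t] is computed along partitions that contain [s], so
    the increment is a limit of Riemann sums over [s, t], which sewing compares
    with the germ. *)
Lemma rough_integral_increment (T th M : R) s t I J :
  1 < th -> 0 <= M ->
  (forall u : R, 0 <= u -> u <= T -> Xi u u = 0) ->
  (forall u v w : R, 0 <= u -> u <= v -> v <= w -> w <= T ->
    `|Xi u w - Xi u v - Xi v w| <= M * (w - u) `^ th) ->
  0 <= s -> s <= t -> t <= T ->
  has_rough_integral W WW z z' s I -> has_rough_integral W WW z z' t J ->
  `|J - I - Xi s t| <= sew_cst th M * (t - s) `^ th.
Proof.
move=> th1 M0 Xi0 dXi s0 st tT /has_rough_integralP HI /has_rough_integralP HJ.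
apply/ler_addgt0Pr => e e0; have e2 : 0 < e / 2 by rewrite divr_gt0.
have [d1 d10 Hd1] := HI _ e2; have [d2 d20 Hd2] := HJ _ e2.
pose dl := Num.min d1 d2; have dl0 : 0 < dl by rewrite lt_min d10.
have fineW a s' c : dl <= c -> fine_path dl a s' -> fine_path c a s'.
  by move=> dc; apply: sub_path => x y /lt_le_trans; apply.
have [s1 [p1 f1]] := fine_partition_exists dl0 s0.
have [s2 [p2 f2]] := fine_partition_exists dl0 st.
have [_ /eqP l1] := p1.
have p12 := itv_partition_cat p1 p2.
have f12 : fine_path dl 0 (s1 ++ s2) by rewrite /fine_path cat_path l1; apply/andP.
have h1 : `|psum Xi 0 s1 - I| < e / 2.
  by apply: Hd1 => //; apply: fineW f1; rewrite ge_min lexx.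
have h2 : `|psum Xi 0 (s1 ++ s2) - J| < e / 2.
  by apply: Hd2 => //; apply: fineW f12; rewrite ge_min lexx orbT.
have h3 := linear_sewing th1 M0 Xi0 dXi s0 tT p2.
rewrite psum_cat l1 in h2.
have -> : J - I - Xi s t = (psum Xi s s2 - Xi s t) + ((psum Xi 0 s1 - I)
    - (psum Xi 0 s1 + psum Xi s s2 - J)) by abel.
apply: le_trans (ler_normD _ _) _; rewrite lerD//.
apply: le_trans (ler_normB _ _) _; lra.
Qed.

End RoughIntegral.

(** * Solutions and Davie paths *)

Section Solutions.
Variables (R : realType) (n d : nat).
Local Notation V := ('cV[R]_d).
Local Notation E := ('M[R]_(d, n)).
Variables (T beta : R) (W : R -> 'cV[R]_n) (WW : R -> R -> 'M[R]_n) (F : V -> E).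
Hypotheses (T0 : 0 < T) (beta3 : 1 / 3 < beta).
Local Notation DF := (fun x => 'd F x).
Local Notation step := (davie_step F DF W WW).

Lemma holder2_bound (U : normedModType R) a (A : R -> R -> U) :
  holder2 T a A -> exists2 C : R, 0 <= C & forall s t,
    0 <= s <= T -> 0 <= t <= T -> s != t -> `|A s t| <= C * `|t - s| `^ a.
Proof.
move=> [C H]; exists `|C| => // s t sT tT st.
have := H s t sT tT st; rewrite ler_pdivrMr; last first.
  by rewrite powR_gt0// normr_gt0 subr_eq0 eq_sym.
by move/le_trans; apply; rewrite ler_wpM2r ?powR_ge0// ler_norm.
Qed.

Lemma holder2_intro (U : normedModType R) a (A : R -> R -> U) C :
  (forall s t, 0 <= s <= T -> 0 <= t <= T -> `|A s t| <= C * `|t - s| `^ a) ->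
  holder2 T a A.
Proof.
move=> H; exists C => s t sT tT st; rewrite ler_pdivrMr; first exact: H.
by rewrite powR_gt0// normr_gt0 subr_eq0 eq_sym.
Qed.

Lemma powR2 (x : R) : x `^ (2 * beta) = (x `^ beta) ^+ 2.
Proof. by rewrite mulrC powRrM powR_mulrn// powR_ge0. Qed.

Lemma rough_path_bounds : rough_path T beta W WW ->
  exists2 C : R, 0 <= C & rough_bounds T beta C W WW.
Proof.
move=> [chen /holder2_bound[C1 C10 H1] /holder2_bound[C2 C20 H2]].
have WW0 s : 0 <= s <= T -> WW s s = 0.
  move=> sT; have := chen s s s sT sT sT.
  by rewrite subrr sub0r /incr subrr mul0mx => /eqP; rewrite oppr_eq0 => /eqP.
exists (C1 + C2); first by rewrite addr_ge0.
split=> // s t s0 st tT.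
  have P0 := powR_ge0 (t - s) beta.
  have [<-|nst] := eqVneq s t.
    by rewrite /incr !subrr normr0 mulr_ge0 ?addr_ge0 ?powR_ge0.
  apply: le_trans (H1 s t _ _ nst) _; try by apply/andP; lra.
  by rewrite ger0_norm ?subr_ge0// ler_wpM2r// lerDl.
have [<-|nst] := eqVneq s t.
  have ss : 0 <= s <= T by apply/andP; lra.
  by rewrite (WW0 s ss) normr0 mulr_ge0 ?addr_ge0 ?exprn_ge0 ?powR_ge0.
apply: le_trans (H2 s t _ _ nst) _; try by apply/andP; lra.
by rewrite ger0_norm ?subr_ge0// powR2 ler_wpM2r ?exprn_ge0 ?powR_ge0// lerDr.
Qed.

Lemma germ_drift (y : R -> V) (y' : R -> E) u v : y' u = F (y u) ->
  germ W WW (F \o y) (comp_deriv F y y') u v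
  = drift F DF (incr W u v) (WW u v) (y u).
Proof.
move=> yu; rewrite /germ /drift /second pair_big /=; congr (_ + _).
by apply: eq_bigr => ij _; rewrite /comp_deriv /= yu.
Qed.

Variables (C K : R).
Hypotheses (C0 : 0 <= C) (K0 : 0 <= K).
Hypotheses (rough : rough_bounds T beta C W WW) (FK : davie_field F DF K).

(** With [y' = F y] the controlled remainder of [y] is of order two, which makes
    the failure of additivity of the germ of order three; it is the expression
    of [drift_defect] with the increment of [y] in place of [v]. *)
Lemma solution_davie xi y y' : rde_solution T beta W WW F xi y y' ->
  exists D, y 0 = xi /\ davie_path T (3 * beta) step y T D.
Proof.
move=> [[/holder2_bound[Cy Cy0 Hy] _ /holder2_bound[CR CR0 HR]] sol].
have yE t : 0 <= t -> t <= T -> y' t = F (y t) by move=> t0 tT; have [] := sol t; rewrite ?t0.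
have [K1 K10 HG] := second_C11 K0 FK.
have [cF cDF rem _] := FK.
have [chen HW HWW] := rough.
have b3 := beta3; have beta0 : 0 < beta by lra.
have th1 : 1 < 3 * beta by lra.
pose S := \sum_(k < d) K; have S0 : 0 <= S by rewrite sumr_ge0.
pose M := n%:R * (K * Cy ^+ 2 * C) + n%:R * (S * CR * C) + C * K1 * Cy.
have M0 : 0 <= M by rewrite /M !(addr_ge0, mulr_ge0, exprn_ge0).
pose Xi := germ W WW (F \o y) (comp_deriv F y y').
have Xi0 u : 0 <= u -> u <= T -> Xi u u = 0.
  move=> u0 uT; rewrite /Xi germ_drift; last exact: yE.
  rewrite /drift (WWxx rough) ?u0// /incr subrr mulmx0 /second big1 ?addr0// => ij _.
  by rewrite mxE scale0r.
have dXi u v w : 0 <= u -> u <= v -> v <= w -> w <= T ->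
    `|Xi u w - Xi u v - Xi v w| <= M * (w - u) `^ (3 * beta).
  move=> u0 uv vw wT.
  have o0 := powR_ge0 (w - u) beta; rewrite powR3.
  rewrite /Xi !germ_drift ?yE//; try lra.
  have ch : WW u w - WW u v - WW v w = incr W u v *m (incr W v w)^T.
    by apply: chen; apply/andP; lra.
  have -> : incr W u w = incr W u v + incr W v w by rewrite /incr; abel.
  have -> : WW u w = WW u v + WW v w + incr W u v *m (incr W v w)^T.
    by rewrite -ch; abel.
  have [W2 WW2] := rough_sub beta0 C0 rough u0 uv vw (lexx w) wT.
  have hv : `|incr y u v| <= Cy * (w - u) `^ beta.
    have [<-|nuv] := eqVneq u v.
      by rewrite /incr subrr normr0 mulr_ge0.
    apply: le_trans (Hy u v _ _ nuv) _; try by apply/andP; lra.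
    rewrite ler_wpM2l// ger0_norm ?subr_ge0//.
    by apply: powR_mono; rewrite ?subr_ge0//; lra.
  have hr : `|incr y u v - F (y u) *m incr W u v| <= CR * ((w - u) `^ beta) ^+ 2.
    have [<-|nuv] := eqVneq u v.
      by rewrite /incr !subrr mulmx0 subrr normr0 mulr_ge0// exprn_ge0.
    rewrite -yE; try lra.
    apply: le_trans (HR u v _ _ nuv) _; try by apply/andP; lra.
    rewrite powR2 ler_wpM2l// ger0_norm ?subr_ge0//.
    rewrite lerXn2r// ?nnegrE ?powR_ge0//.
    by apply: powR_mono; rewrite ?subr_ge0//; lra.
  have yv : y v = y u + incr y u v by rewrite /incr; abel.
  rewrite yv; move: (incr y u v) hv hr => v' hv hr.
  move: (incr W u v) (incr W v w) W2 hr => w1 w2 W2 hr.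
  move: (WW u v) (WW v w) WW2 => A1 A2 WW2.
  have [_ lG _] := HG A2.
  set x := y u in hr *; set o := (w - u) `^ beta in o0 W2 WW2 hv hr *.
  have -> : drift F DF (w1 + w2) (A1 + A2 + w1 *m w2^T) x - drift F DF w1 A1 x
      - drift F DF w2 A2 (x + v') =
    - ((F (x + v') - F x - DF x v') *m w2 + DF x (v' - F x *m w1) *m w2
      + (second F DF (x + v') A2 - second F DF x A2)).
    rewrite (linearB (DF x)) !mulmxBl -(second_tensor F DF x w1 w2) /drift.
    by rewrite !secondD mulmxDr; abel.
  rewrite normrN.
  have r1 : `|F (x + v') - F x - DF x v'| <= K * (Cy * o) ^+ 2.
    by apply: le_trans (rem x v') _; rewrite ler_wpM2l// lerXn2r// nnegrE// mulr_ge0.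
  have r2 : `|DF x (v' - F x *m w1)| <= S * (CR * o ^+ 2).
    apply: le_trans (@linear_le _ _ _ (DF x) (fun=> K) _ _) _.
      by move=> k; have [b _ _] := cDF k; exact: b.
    by rewrite ler_wpM2l.
  have r3 : `|second F DF (x + v') A2 - second F DF x A2| <= C * o ^+ 2 * K1 * (Cy * o).
    apply: le_trans (lG _ _) _; rewrite [x + v' - x]addrAC subrr add0r.
    by apply: ler_pM => //; [rewrite mulr_ge0 | rewrite ler_wpM2r].
  apply: le_trans (ler_normD _ _) _; apply: le_trans (lerD (ler_normD _ _) r3) _.
  apply: le_trans (lerD (lerD (mulmx_le r1 W2) (mulmx_le r2 W2)) (lexx _)) _.
  by rewrite le_eqVlt /M; apply/orP; left; apply/eqP; ring.
exists (sew_cst (3 * beta) M); split.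
  have [|[I HI ->] _] := sol 0; first by rewrite lexx ltW.
  suff -> : I = 0 by rewrite addr0.
  apply/eqP; rewrite -normr_le0; apply/ler_addgt0Pr => e e0; rewrite add0r.
  move/has_rough_integralP : HI => /(_ e e0)[dl _ /(_ [::])].
  by rewrite psum_nil sub0r normrN => H; apply/ltW/H.
move=> s t s0 st tT _.
have [|[I HI yI] _] := sol s; first by rewrite s0 (le_trans st).
have [|[J HJ yJ] _] := sol t; first by rewrite (le_trans s0).
have := rough_integral_increment th1 M0 Xi0 dXi s0 st tT HI HJ.
rewrite germ_drift; last by apply: yE => //; lra.
have -> : J - I = y t - y s by rewrite yI yJ; abel.
by rewrite /davie_step [- (y s + _)]opprD addrA.
Qed.

(** A long increment is a sum of boundedly many short ones. *)
Lemma local_increment_bound (y : R -> V) (h B : R) : 0 < h -> 0 <= B ->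
  (forall s t : R, 0 <= s -> s <= t -> t <= T -> t - s <= h -> `|y t - y s| <= B) ->
  exists2 B' : R, 0 <= B' & forall s t : R, 0 <= s -> s <= t -> t <= T ->
    `|y t - y s| <= B'.
Proof.
move=> h0 B0 H; pose m := Num.bound (T / h).
have mh : T <= m.+1%:R * h.
  rewrite -ler_pdivrMr//; apply: ltW; apply: lt_le_trans (archi_boundP _) _.
    by rewrite divr_ge0// ltW.
  by rewrite ler_nat.
exists (m.+1%:R * B); first by rewrite mulr_ge0.
move=> s t s0 st tT; have : t - s <= m.+1%:R * h by lra.
elim: m t st tT {mh} => [|m IH] t st tT sth.
  have sth' : t - s <= h by lra.
  by apply: le_trans (H s t s0 st tT sth') _; lra.
have B1 : 0 <= m.+1%:R * B by rewrite mulr_ge0.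
rewrite -(natr1 m.+1) mulrDl mul1r in sth.
rewrite -(natr1 m.+1) mulrDl mul1r.
have [sh|sh] := leP (t - s) h; first by apply: le_trans (H s t s0 st tT sh) _; lra.
have -> : y t - y s = (y (t - h) - y s) + (y t - y (t - h)) by abel.
by apply: le_trans (ler_normD _ _) _; apply: lerD; [apply: IH | apply: H]; lra.
Qed.

(** The drift and the increment of [y] differ by the power [th] of the duration,
    which below a small mesh is a small multiple of the duration itself. *)
Lemma davie_sum_cvg (y : R -> V) (h D : R) th t (e : R) : 1 < th -> 0 < h ->
  0 <= t -> t <= T -> 0 < e -> davie_path T th step y h D ->
  exists2 delta : R, 0 < delta & forall s, itv_partition 0 t s ->
    fine_path delta 0 s ->
    `|psum (fun u v => drift F DF (incr W u v) (WW u v) (y u)) 0 s - (y t - y 0)| < e.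
Proof.
move=> th1 h0 t0 tT e0 dy.
have th10 : 0 < th - 1 by lra.
have e2 : 0 < e / 2 by rewrite divr_gt0.
have [dl dl0 Hdl] := powR_small (`|D| * (T + 1)) th10 e2.
exists (Num.min h dl); first by rewrite lt_min h0.
move=> s ps fs; set Z := fun u v => _.
have T1 : 0 < T + 1 by have := T0; lra.
have step_le u v : 0 <= u -> u <= v -> v <= T -> v - u < Num.min h dl ->
    `|Z u v - (y v - y u)| <= e / 2 / (T + 1) * (v - u).
  move=> u0 uv vT; rewrite lt_min => /andP[uvh uvd].
  have vu0 : 0 <= v - u by rewrite subr_ge0.
  have -> : Z u v - (y v - y u) = - (y v - step u v (y u)).
    by rewrite /Z /davie_step; move: (drift _ _ _ _ _) => w; abel.
  rewrite normrN; apply: le_trans (dy _ _ u0 uv vT (ltW uvh)) _.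
  have -> : (v - u) `^ th = (v - u) `^ (th - 1) * (v - u).
    have [->|nz] := eqVneq (v - u) 0; first by rewrite mulr0 powR0//; lra.
    by rewrite -[X in _ * X]powRr1// -powRD ?subrK// nz implybT.
  rewrite mulrA ler_wpM2r//.
  have := Hdl _ vu0 (ltW uvd); rewrite mulrAC -ler_pdivlMr// => /(le_trans _); apply.
  by rewrite ler_wpM2r ?powR_ge0// ler_norm.
clearbody Z.
have tel b a s' : 0 <= a -> b <= T -> itv_partition a b s' ->
    fine_path (Num.min h dl) a s' ->
    `|psum Z a s' - (y b - y a)| <= e / 2 / (T + 1) * (b - a).
  move=> a0 bT; elim: s' a a0 => [|x s' IH] a a0 ps' fs'.
    by rewrite (itv_partition_nil ps') psum_nil !subrr normr0 mulr0.
  have xb := itv_partition_le (itv_partition_cons ps').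
  have [/= /andP[ax _] _] := ps'.
  have /= /andP[xa fx] := fs'.
  have x0 : 0 <= x := le_trans a0 (ltW ax).
  have h1 := IH x x0 (itv_partition_cons ps') fx.
  have h2 := step_le a x a0 (ltW ax) (le_trans xb bT) xa.
  rewrite psum_cons.
  have -> : Z a x + psum Z x s' - (y b - y a) =
    (Z a x - (y x - y a)) + (psum Z x s' - (y b - y x)) by abel.
  by apply: le_trans (ler_normD _ _) _; apply: le_trans (lerD h2 h1) _; lra.
apply: le_lt_trans (tel t 0 s (lexx 0) tT ps fs) _.
rewrite subr0 mulrAC ltr_pdivrMr//.
have : e / 2 * t <= e / 2 * T by rewrite ler_wpM2l// ltW.
have : 0 < e * T by rewrite mulr_gt0.
by lra.
Qed.

(** On durations up to [h] the Davie estimate gives the bounds of a controlled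
    path; on longer ones they follow from boundedness of the increments of [y],
    at the price of powers of [h `^ beta]. *)
Lemma davie_solution xi (y : R -> V) (h D : R) : 0 < h -> y 0 = xi ->
  davie_path T (3 * beta) step y h D ->
  rde_solution T beta W WW F xi y (F \o y).
Proof.
move=> h0 y0 dy.
have b3 := beta3; have beta0 : 0 < beta by lra.
have th1 : 1 < 3 * beta by lra.
have [[bF lF _] _ _ _] := FK; have [chen HW HWW] := rough.
have [c c0 Hc] := drift_C11 K0 FK.
have [K1 K10 HG] := second_C11 K0 FK.
pose Om := T `^ beta; have Om0 : 0 <= Om := powR_ge0 _ _.
have omO (s t : R) : 0 <= s -> s <= t -> t <= T -> (t - s) `^ beta <= Om.
  by move=> s0 st tT; apply: powR_mono; [exact: ltW | rewrite subr_ge0 | lra].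
(* bounds on durations at most h *)
pose B1 := `|D| * Om ^+ 2 + c * (C * (1 + Om)).
have B10 : 0 <= B1 by rewrite /B1 !(addr_ge0, mulr_ge0, exprn_ge0).
pose B2 := `|D| * Om + C * K1.
have B20 : 0 <= B2 by rewrite /B2 !(addr_ge0, mulr_ge0).
have near1 s t : 0 <= s -> s <= t -> t <= T -> t - s <= h ->
    `|y t - y s| <= B1 * (t - s) `^ beta.
  move=> s0 st tT sth; have := dy s t s0 st tT sth; rewrite powR3.
  have o0 := powR_ge0 (t - s) beta; have oO := omO s t s0 st tT.
  have W1 := HW s t s0 st tT; have W2 := HWW s t s0 st tT.
  have [bd _ _] := Hc (incr W s t) (WW s t); have {}bd := bd (y s).
  set o := (t - s) `^ beta in o0 oO W1 W2 *; move=> H.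
  have -> : y t - y s = (y t - step s t (y s)) + drift F DF (incr W s t) (WW s t) (y s).
    by rewrite /davie_step; move: (drift _ _ _ _ _) => w; abel.
  apply: le_trans (ler_normD _ _) _; apply: le_trans (lerD H bd) _.
  rewrite /B1 mulrDl; apply: lerD.
    apply: le_trans (ler_wpM2r (exprn_ge0 3 o0) (ler_norm D)) _.
    by rewrite -mulrA ler_wpM2l// exprSr ler_wpM2r// lerXn2r// nnegrE.
  rewrite -!mulrA ler_wpM2l//; apply: le_trans (lerD W1 W2) _.
  by rewrite -mulrDr ler_wpM2l// mulrDl mul1r lerD2l expr2 ler_wpM2r.
have near2 s t : 0 <= s -> s <= t -> t <= T -> t - s <= h ->
    `|incr y s t - F (y s) *m incr W s t| <= B2 * ((t - s) `^ beta) ^+ 2.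
  move=> s0 st tT sth; have := dy s t s0 st tT sth; rewrite powR3.
  have o0 := powR_ge0 (t - s) beta; have oO := omO s t s0 st tT.
  have W2 := HWW s t s0 st tT.
  have [bd _ _] := HG (WW s t); have {}bd := bd (y s).
  set o := (t - s) `^ beta in o0 oO W2 *; move=> H.
  have -> : incr y s t - F (y s) *m incr W s t
      = (y t - step s t (y s)) + second F DF (y s) (WW s t).
    rewrite /davie_step /drift; move: (incr W s t) => w; rewrite /incr.
    by move: (second F DF (y s) (WW s t)) (F (y s) *m w) => w1 w2; abel.
  apply: le_trans (ler_normD _ _) _; apply: le_trans (lerD H bd) _.
  rewrite /B2 mulrDl; apply: lerD.
    apply: le_trans (ler_wpM2r (exprn_ge0 3 o0) (ler_norm D)) _.
    by rewrite -mulrA ler_wpM2l// exprS ler_wpM2r// exprn_ge0.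
  by rewrite mulrAC ler_wpM2r.
(* bounds on all durations *)
have [|G G0 HGl] := @local_increment_bound y h (B1 * Om) h0 (mulr_ge0 B10 Om0).
  move=> s t s0 st tT sth; apply: le_trans (near1 s t s0 st tT sth) _.
  by rewrite ler_wpM2l// omO.
pose hb := h `^ beta; have hb0 : 0 < hb by rewrite powR_gt0.
have far s t : h < t - s -> 1 <= (t - s) `^ beta / hb.
  move=> hts; rewrite ler_pdivlMr// mul1r.
  by apply: powR_mono; [exact: ltW | exact: ltW | exact: ltW].
pose L1 := B1 + G / hb.
have Gh0 : 0 <= G / hb by rewrite divr_ge0// ltW.
have L10 : 0 <= L1 by rewrite /L1 addr_ge0.
have glob1 s t : 0 <= s -> s <= t -> t <= T -> `|y t - y s| <= L1 * (t - s) `^ beta.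
  move=> s0 st tT; have o0 := powR_ge0 (t - s) beta.
  have [sth|sth] := leP (t - s) h.
    apply: le_trans (near1 s t s0 st tT sth) _.
    by rewrite ler_wpM2r// lerDl.
  apply: le_trans (HGl s t s0 st tT) _.
  apply: le_trans (ler_peMr G0 (far s t sth)) _.
  by rewrite mulrCA mulrC ler_wpM2r// lerDr.
pose A := G + n%:R * (K * (C * Om)).
have A0 : 0 <= A by rewrite /A !(addr_ge0, mulr_ge0).
have Ah0 : 0 <= A / hb / hb := divr_ge0 (divr_ge0 A0 (ltW hb0)) (ltW hb0).
pose L2 := B2 + A / hb / hb.
have L20 : 0 <= L2 := addr_ge0 B20 Ah0.
have glob2 s t : 0 <= s -> s <= t -> t <= T ->
    `|incr y s t - F (y s) *m incr W s t| <= L2 * ((t - s) `^ beta) ^+ 2.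
  move=> s0 st tT; have o0 := powR_ge0 (t - s) beta.
  have [sth|sth] := leP (t - s) h.
    apply: le_trans (near2 s t s0 st tT sth) _.
    by rewrite ler_wpM2r ?exprn_ge0// lerDl.
  have f1 := far s t sth.
  apply: (@le_trans _ _ A).
    apply: le_trans (ler_normB _ _) _; apply: lerD; first exact: HGl.
    apply: mulmx_le; first exact: bF.
    by apply: le_trans (HW s t s0 st tT) _; rewrite ler_wpM2l// omO.
  apply: le_trans (_ : A * ((t - s) `^ beta / hb * ((t - s) `^ beta / hb)) <= _).
    by rewrite ler_peMr// mulr_ege1.
  apply: le_trans (_ : A / hb / hb * ((t - s) `^ beta) ^+ 2 <= _).
    by rewrite le_eqVlt; apply/orP; left; apply/eqP; ring.
  by rewrite ler_wpM2r ?exprn_ge0// lerDr.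
have sym1 s t : 0 <= s <= T -> 0 <= t <= T -> `|incr y s t| <= L1 * `|t - s| `^ beta.
  move=> /andP[s0 sT] /andP[t0 tT]; have [st|ts] := leP s t.
    by rewrite ger0_norm ?subr_ge0//; exact: glob1.
  have -> : `|t - s| = s - t by rewrite distrC ger0_norm ?subr_ge0// ltW.
  by rewrite /incr distrC; apply: glob1 => //; exact: ltW.
split; last first.
  move=> t tT; split => //; exists (y t - xi); last by rewrite addrC subrK.
  have /andP[t0 tT'] := tT.
  apply/has_rough_integralP => e e0.
  have [dl dl0 H] := davie_sum_cvg th1 h0 t0 tT' e0 dy.
  exists dl => // s ps fs; have := H s ps fs; rewrite y0.
  set Z := fun u v => _.
  suff -> : psum (germ W WW (F \o y) (comp_deriv F y (F \o y))) 0 s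
    = psum Z 0 s by [].
  by apply: eq_bigr => k _; exact: germ_drift.
split.
- exact: holder2_intro sym1.
- apply: (@holder2_intro _ _ _ (K * L1)) => s t sT tT.
  apply: le_trans (lF _ _) _; rewrite -mulrA ler_wpM2l//; exact: sym1.
- apply: (@holder2_intro _ _ _ (L2 + n%:R * (K * L1 * C))) => s t /andP[s0 sT] /andP[t0 tT].
  rewrite powR2 /=; have [st|ts] := leP s t.
    rewrite ger0_norm ?subr_ge0//; apply: le_trans (glob2 s t s0 st tT) _.
    rewrite ler_wpM2r ?exprn_ge0 ?powR_ge0// lerDl.
    exact: mulr_ge0 (ler0n _ _) (mulr_ge0 (mulr_ge0 K0 L10) C0).
  have ts' := ltW ts.
  have -> : `|t - s| = s - t by rewrite distrC ger0_norm ?subr_ge0.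
  have o0 := powR_ge0 (s - t) beta.
  have -> : incr y s t - F (y s) *m incr W s t = - (incr y t s - F (y t) *m incr W t s)
     + (F (y s) - F (y t)) *m incr W t s.
    have -> : incr W s t = - incr W t s by rewrite /incr opprB.
    have -> : incr y s t = - incr y t s by rewrite /incr opprB.
    by rewrite mulmxBl mulmxN; abel.
  apply: le_trans (ler_normD _ _) _; rewrite normrN mulrDl; apply: lerD; first exact: glob2.
  have h1 : `|F (y s) - F (y t)| <= K * (L1 * (s - t) `^ beta).
    by apply: le_trans (lF _ _) _; rewrite ler_wpM2l//; apply: glob1.
  apply: le_trans (mulmx_le h1 (HW t s t0 ts' sT)) _.
  by rewrite le_eqVlt; apply/orP; left; apply/eqP; ring.
Qed.

End Solutions.

Theorem corollary10p2 (R : realType) (n d : nat) (T beta : R)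
    (xi : 'cV[R]_d) (F : 'cV[R]_d -> 'M[R]_(d, n))
    (W : R -> 'cV[R]_n) (WW : R -> R -> 'M[R]_n) :
  0 < T -> 1 / 3 < beta -> beta < 1 / 2 ->
  Cb 3 F -> rough_path T beta W WW ->
  exists (y : R -> 'cV[R]_d) (y' : R -> 'M[R]_(d, n)),
    rde_solution T beta W WW F xi y y' /\
    forall (x : R -> 'cV[R]_d) (x' : R -> 'M[R]_(d, n)),
      rde_solution T beta W WW F xi x x' ->
      forall t, 0 <= t <= T -> x t = y t /\ x' t = y' t.
Proof.
move=> T0 beta3 _ /Cb_davie_field[K K0 FK] /rough_path_bounds[C C0 rough].
have beta0 : 0 < beta by lra.
have th1 : 1 < 3 * beta by lra.
have [M M0 flow] := davie_step_flow K0 FK beta0 C0 rough (ltW T0).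
have [y [h [D [h0 D0 y0 dy]]]] := almost_flow_exists th1 beta0 (ltW T0) M0 flow xi.
exists y, (F \o y); split.
  exact (davie_solution T0 beta3 C0 K0 rough FK h0 y0 dy).
move=> x x' sol t /andP[t0 tT].
have [D' [x0 dx]] := solution_davie T0 beta3 C0 K0 rough FK sol.
have xy : x t = y t.
  by apply: (almost_flow_unique th1 beta0 (ltW T0) M0 flow T0 h0 dx dy) => //; rewrite x0.
split=> //; have [_ s] := sol; have [_ ->] := s t (introT andP (conj t0 tT)).
by rewrite xy.
Qed.
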